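(* Let $\mathcal G(A,D)=(\mathcal V_A\cup\mathcal V_D,\mathcal E)$ be a graph with a specific node bipartition and let $p\in\mathbb R^{2n}$ be a generic configuration. (i) If $(\mathcal G(A,D),p)$ is SA-RoD rigid, then $\mathcal G(A,D)$ is generically SA-RoD rigid, i.e. $(\mathcal G(A,D),q)$ is SA-RoD rigid for every generic configuration $q\in\mathbb R^{2n}$. (ii) If $(\mathcal G(A,D),p)$ is infinitesimally SA-RoD rigid, then $\mathcal G(A,D)$ is generically infinitesimally SA-RoD rigid, i.e. $(\mathcal G(A,D),q)$ is infinitesimally SA-RoD rigid for every generic configuration $q\in\mathbb R^{2n}$.
   Context: $\mathcal{G}=(\mathcal V,\mathcal E)$ is a finite simple undirected graph, $\mathcal V=\{1,\dots,n\}$, $n\ge 3$. A node bipartition is $\mathcal V=\mathcal V_A\cup\mathcal V_D$ with $\mathcal V_A,\mathcal V_D$ disjoint and nonempty; $\mathcal K(A,D)$ is the complete graph on $\mathcal V$ with the same bipartition. A configuration is $p=(p_1^\top,\dots,p_n^\top)^\top\in\mathbb R^{2n}$, $p_i\in\mathbb R^2$; the points of a framework are pairwise distinct. A configuration is generic if its coordinates do not satisfy any nonzero polynomial equation with integer coefficients. $e_{ij}=p_j-p_i$, $b_{ij}=e_{ij}/\|e_{ij}\|$, $\mathcal R(\theta)$ is the counter-clockwise rotation matrix. $\mathcal T_A=\{(u,v,w)\in\mathcal V^3: u\in\mathcal V_A,(u,v),(u,w)\in\mathcal E,v<w\}$, and $\mathcal T_D$ likewise with $u\in\mathcal V_D$.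 $\alpha_{rst}\in[0,2\pi)$ is the counter-clockwise signed angle from $b_{rs}$ to $b_{rt}$; $\kappa_{ijk}=\|e_{ik}\|/\|e_{ij}\|$. $f_{\mathcal G(A,D)}(p)=(\ldots,\alpha_{rst},\ldots,\kappa_{ijk},\ldots)^\top$, $(r,s,t)\in\mathcal T_A$, $(i,j,k)\in\mathcal T_D$, defined where adjacent vertices are distinct; likewise $f_{\mathcal K(A,D)}$. $(\mathcal G(A,D),p)$ is SA-RoD rigid if there is an open neighborhood $U_p$ of $p$ with $f^{-1}_{\mathcal{G}(A,D)}(f_{\mathcal{G}(A,D)}(p))\cap U_{p}=f^{-1}_{\mathcal{K}(A,D)}(f_{\mathcal{K}(A,D)}(p))\cap U_{p}$. It is infinitesimally SA-RoD rigid if every $\delta p\in\mathbb R^{2n}$ in the kernel of the Jacobian of $f_{\mathcal G(A,D)}$ at $p$ (angles differentiated modulo $2\pi$), i.e. satisfying $\frac{b_{rs}^\top\mathcal R(\pi/2)}{\|e_{rs}\|}(\delta p_s-\delta p_r)-\frac{b_{rt}^\top\mathcal R(\pi/2)}{\|e_{rt}\|}(\delta p_t-\delta p_r)=0$ for $(r,s,t)\in\mathcal T_A$ and $\frac{b_{ik}^\top}{\|e_{ik}\|}(\delta p_k-\delta p_i)-\frac{b_{ij}^\top}{\|e_{ij}\|}(\delta p_j-\delta p_i)=0$ for $(i,j,k)\in\mathcal T_D$, lies in the span of $\mathbf 1_n\otimes(1,0)^\top$, $\mathbf 1_n\otimes(0,1)^\top$, $(I_n\otimes\mathcal R(\pi/2))p$,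 $p$. *)

(* Defs.v *)
From HB Require Import structures.
(* The notations of [mpoly] clash with those of analysis. *)
From mathcomp Require Import -(notations) mpoly.
From mathcomp Require Import all_boot all_order all_algebra.
From mathcomp Require Import all_classical all_reals all_analysis.
From mathcomp Require Import ring lra.

Set Implicit Arguments.
Unset Strict Implicit.
Unset Printing Implicit Defensive.

Import Order.TTheory GRing.Theory Num.Theory.
Import numFieldNormedType.Exports.

Local Open Scope ring_scope.

Definition simple_graph (n : nat) (e : rel 'I_n) : Prop :=
  symmetric e /\ irreflexive e.

Definition complete_graph (n : nat) : rel 'I_n := fun i j => i != j.

Definition node_bipartition (n : nat) (A D : {set 'I_n}) : Prop :=
  [/\ A :|: D = finset.setT, [disjoint A & D], A != finset.set0
    & D != finset.set0].

(* The triples (u, v, w) with u in B, uv and uw edges and v < w: this is T_A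
   for B := A and T_D for B := D. *)
Definition triples (n : nat) (e : rel 'I_n) (B : {set 'I_n}) :
    {set 'I_n * 'I_n * 'I_n} :=
  [set x | [&& x.1.1 \in B, e x.1.1 x.1.2, e x.1.1 x.2
             & (x.1.2 < x.2)%N]].

Local Open Scope classical_set_scope.

Section Plane.
Variable R : realType.

(* The norm [`|v|] on matrices is the sup norm, not the Euclidean one. *)
Definition enorm (v : 'cV[R]_2) : R := Num.sqrt (\sum_i v i 0 ^+ 2).

Definition rotation (t : R) : 'M[R]_2 :=
  \matrix_(i, j) if i == j then cos t
                 else if i == 0 then - sin t else sin t.

(* The t in [0, 2 pi[ such that rotating b by t counter-clockwise gives c;
   it exists and is unique for unit vectors (see [signed_angleP]). *)
Definition signed_angle (b c : 'cV[R]_2) : R :=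
  get [set t : R | 0 <= t < 2 * pi /\ c = rotation t *m b].

Let enorm1 v : enorm v = 1 -> v 0 0 ^+ 2 + v 1 0 ^+ 2 = 1.
Proof.
rewrite /enorm !big_ord_recl big_ord0 addr0 => h.
have -> : 1 = lift ord0 ord0 :> 'I_2 by apply/val_inj.
by rewrite -[LHS]sqr_sqrtr ?addr_ge0 ?sqr_ge0// h expr1n.
Qed.

Let angle_exists (x y : R) : x ^+ 2 + y ^+ 2 = 1 ->
  exists2 t, 0 <= t < 2 * pi & cos t = x /\ sin t = y.
Proof.
move=> h.
have x1 : -1 <= x <= 1 by apply/andP; split; nra.
have ax : cos (acos x) = x by rewrite acosK// in_itv.
have sy : sin (acos x) = `|y|.
  by rewrite sin_acos// -h addrAC subrr add0r sqrtr_sqr.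
have p0 := @pi_gt0 R.
have a0 := acos_ge0 x1; have api := acos_lepi x1.
have [y0|y0] := leP 0 y.
  exists (acos x); first by apply/andP; split; lra.
  by rewrite ax sy ger0_norm.
have ap : 0 < acos x.
  rewrite lt_neqAle a0 andbT; apply/eqP => /esym a; move: sy; rewrite a sin0 => /esym/normr0_eq0; lra.
exists (2 * pi - acos x).
  move: (acos x) a0 api ap => a *; apply/andP; split; lra.
rewrite mulr_natl cosB sinB cos2pi sin2pi ax sy ltr0_norm//.
by split; ring.
Qed.

Let angle_unique (s t : R) : 0 <= s < 2 * pi -> 0 <= t < 2 * pi ->
  cos s = cos t -> sin s = sin t -> s = t.
Proof.
wlog st : s t / s <= t => [H|].
  by case/orP: (le_total s t) => ? ? ? ? ?; [|symmetry]; apply: H.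
move=> s2 t2 c1 c2; apply/eqP; apply: contraT => nst.
have st' : s < t by rewrite lt_neqAle nst.
have d0 : 0 < (t - s) / 2 < pi by apply/andP; split; lra.
have /exprn_gt0 - /(_ 2) s0 := sin_gt0_pi d0.
have h : cos (t - s) = 1 by rewrite cosB c1 c2 -!expr2 cos2Dsin2.
have e : t - s = (t - s) / 2 + (t - s) / 2 by field.
move: h; rewrite e cosD -!expr2 => h.
have := cos2Dsin2 ((t - s) / 2); lra.
Qed.

Lemma signed_angleP b c t : enorm b = 1 -> enorm c = 1 ->
  signed_angle b c = t <-> 0 <= t < 2 * pi /\ c = rotation t *m b.
Proof.
move=> /enorm1 hb /enorm1 hc.
have rotE u : c = rotation u *m b <->
    cos u = b 0 0 * c 0 0 + b 1 0 * c 1 0 /\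
    sin u = b 0 0 * c 1 0 - b 1 0 * c 0 0.
  have l1 : lift ord0 ord0 = 1 :> 'I_2 by apply/val_inj.
  have E0 : (rotation u *m b) 0 0 = cos u * b 0 0 - sin u * b 1 0.
    by rewrite !mxE !big_ord_recl big_ord0 !mxE/= l1; ring.
  have E1 : (rotation u *m b) 1 0 = sin u * b 0 0 + cos u * b 1 0.
    by rewrite !mxE !big_ord_recl big_ord0 !mxE/= l1; ring.
  split=> [cE|[cu su]].
    rewrite cE E0 E1; split.
      by rewrite -[LHS]mulr1 -hb; ring.
    by rewrite -[LHS]mulr1 -hb; ring.
  apply/matrixP => i j; rewrite (ord1 j).
  have [->|->] : i = 0 \/ i = 1.
    by case: i => -[|[|//]] ?; [left|right]; apply/val_inj.
  - by rewrite E0 cu su -[LHS]mulr1 -hb; ring.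
  - by rewrite E1 cu su -[LHS]mulr1 -hb; ring.
have [|u u2 [cu su]] :=
  @angle_exists (b 0 0 * c 0 0 + b 1 0 * c 1 0)
                (b 0 0 * c 1 0 - b 1 0 * c 0 0).
  by rewrite -[RHS]mulr1 -{1}hb -hc; ring.
have uP : 0 <= u < 2 * pi /\ c = rotation u *m b by split=> //; apply/rotE.
have [aI /rotE[ca sa]] := @getPex _ [set t : R | 0 <= t < 2 * pi /\
  c = rotation t *m b] (ex_intro _ u uP).
split=> [<-|[tI /rotE[ct st]]]; first by split=> //; apply/rotE.
by apply: angle_unique => //; rewrite /signed_angle ?ca ?sa ?ct ?st.
Qed.

End Plane.

Section Framework.
Variables (R : realType) (n : nat).

(* A configuration p in R^(2n) is an n x 2 matrix whose i-th row is p_i^T;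
   [mxvec p] is the stacked vector (p_1^T, ..., p_n^T). *)
Implicit Types p q dp : 'M[R]_(n, 2).

Definition point p (i : 'I_n) : 'cV[R]_2 := (row i p)^T.

Definition edge_vec p (i j : 'I_n) : 'cV[R]_2 := point p j - point p i.

Definition edge_len p (i j : 'I_n) : R := enorm (edge_vec p i j).

Definition bearing p (i j : 'I_n) : 'cV[R]_2 :=
  (edge_len p i j)^-1 *: edge_vec p i j.

Definition alpha p (r s t : 'I_n) : R :=
  signed_angle (bearing p r s) (bearing p r t).

Definition kappa p (i j k : 'I_n) : R := edge_len p i k / edge_len p i j.

Definition generic p : Prop :=
  forall P : mpoly (n * 2)%N int, P != 0 ->
    mmap (intr : int -> R) (fun k => mxvec p 0 k) P != 0.

Variables (e : rel 'I_n) (A D : {set 'I_n}).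

Definition sarod_dom : set 'M[R]_(n, 2) :=
  [set p | forall i j, e i j -> point p i <> point p j].

Definition sarod_map p :
    {ffun {x | x \in triples e A} + {x | x \in triples e D} -> R} :=
  [ffun x => match x with
             | inl y => alpha p (val y).1.1 (val y).1.2 (val y).2
             | inr y => kappa p (val y).1.1 (val y).1.2 (val y).2
             end].

Definition sarod_fiber p : set 'M[R]_(n, 2) :=
  [set q | sarod_dom q /\ sarod_map q = sarod_map p].

(* The derivative of alpha_rst in the direction dp. *)
Definition dalpha p dp (r s t : 'I_n) : 'M[R]_1 :=
  let term v := (edge_len p r v)^-1 *:
    ((bearing p r v)^T *m rotation (pi / 2) *m edge_vec dp r v) in
  term s - term t.

(* The derivative of ln kappa_ijk in the direction dp: it differs from that of
   kappa_ijk by the factor kappa_ijk > 0, hence has the same kernel. *)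
Definition dkappa p dp (i j k : 'I_n) : 'M[R]_1 :=
  let term v := (edge_len p i v)^-1 *:
    ((bearing p i v)^T *m edge_vec dp i v) in
  term k - term j.

Definition infinitesimal_motion p dp : Prop :=
  (forall r s t, (r, s, t) \in triples e A -> dalpha p dp r s t = 0) /\
  (forall i j k, (i, j, k) \in triples e D -> dkappa p dp i j k = 0).

Definition translation (c : 'I_2) : 'M[R]_(n, 2) := \matrix_(i, j) (j == c)%:R.

(* Rows are transposed points, so rotating every p_i by pi / 2 is right
   multiplication by the transposed rotation matrix. *)
Definition trivial_motions p : {vspace 'M[R]_(n, 2)} :=
  let X := [:: translation 0; translation 1; p *m (rotation (pi / 2))^T; p] in
  <<X>>%VS.

Definition inf_sarod_rigid p : Prop :=
  forall dp, infinitesimal_motion p dp -> dp \in trivial_motions p.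

End Framework.

Definition sarod_rigid (R : realType) (n : nat) (e : rel 'I_n)
    (A D : {set 'I_n}) (p : 'M[R]_(n, 2)) : Prop :=
  exists U : set 'M[R]_(n, 2), [/\ open U, U p &
    sarod_fiber e A D p `&` U = sarod_fiber (@complete_graph n) A D p `&` U].

Definition generically_sarod_rigid (R : realType) (n : nat) (e : rel 'I_n)
    (A D : {set 'I_n}) : Prop :=
  forall q : 'M[R]_(n, 2), generic q -> sarod_rigid e A D q.

Definition generically_inf_sarod_rigid (R : realType) (n : nat)
    (e : rel 'I_n) (A D : {set 'I_n}) : Prop :=
  forall q : 'M[R]_(n, 2), generic q -> inf_sarod_rigid e A D q.

(* Main.v *)
(* Near a generic configuration the signed angles and the ratios of distances can
   be replaced by quotients of integer quadratic forms: the tangents of the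
   angles and the squares of the ratios.  After clearing denominators their
   derivatives form a matrix of integer polynomials, whose rank is the same at
   all generic configurations and maximal there, because a minor that vanishes
   at one generic point is the zero polynomial.
   - The infinitesimal motions are the kernel of this matrix, and for a generic
     configuration the trivial motions are spanned by four independent elements
     of it, so (ii) is a statement about the rank.
   - By the constant rank theorem, the fiber of the constraints of G coincides
     with the fiber of those of K near a generic point if and only if both
     families of derivatives have the same rank, which gives (i). *)
From HB Require Import structures.
Require Import Defs.
From mathcomp Require Import -(notations) mpoly.
From mathcomp Require Import all_boot all_order all_algebra.
From mathcomp Require Import all_classical all_reals all_analysis.
From mathcomp Require Import ring lra.

Set Implicit Arguments.
Unset Strict Implicit.
Unset Printing Implicit Defensive.

Import Order.TTheory GRing.Theory Num.Theory.
Import numFieldNormedType.Exports.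

Local Open Scope classical_set_scope.
Local Open Scope ring_scope.

(* Makes HB build the join with the normed structure of matrices. *)
HB.instance Definition _ (R : realType) (m n : nat) :=
  Uniform_isComplete.Build 'M[R]_(m, n) (@mx_complete R m n).

(** * Sup norm estimates for matrices *)

Section MatrixNorm.
Variable R : realType.

Lemma mx_norm_leP m n (A : 'M[R]_(m, n)) (c : R) : 0 <= c ->
  (forall i j, `|A i j| <= c) -> `|A| <= c.
Proof.
move=> c0 Ac; rewrite [leLHS]/Num.norm/= mx_normrE.
by apply/bigmax_leP; split=> // -[i j] _; exact: Ac.
Qed.

Lemma le_mx_norm m n (A : 'M[R]_(m, n)) i j : `|A i j| <= `|A|.
Proof.
rewrite [leRHS]/Num.norm/= mx_normrE.
by apply/bigmax_geP; right; exists (i, j).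
Qed.

Lemma mx_norm_mulmx m n k (A : 'M[R]_(m, n)) (B : 'M[R]_(n, k)) :
  `|A *m B| <= n%:R * `|B| * `|A|.
Proof.
apply: mx_norm_leP => [|i j]; first by rewrite !mulr_ge0.
rewrite mxE; apply: le_trans (ler_norm_sum _ _ _) _.
have -> : n%:R * `|B| * `|A| = \sum_(l < n) `|B| * `|A|.
  by rewrite -mulrA mulr_natl sumr_const card_ord.
apply: ler_sum => l _; rewrite normrM mulrC.
by apply: ler_pM => //; exact: le_mx_norm.
Qed.

End MatrixNorm.

(** * Inversion of maps close to the identity *)

Section LocalInverse.
Variables (R : realType) (m : nat) (F : 'rV[R]_m -> 'rV[R]_m).
Variables (q : 'rV[R]_m) (rho : R).
Hypothesis rho_gt0 : 0 < rho.
Hypothesis F_near_id : forall x y, `|x - q| <= rho -> `|y - q| <= rho ->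
  `|F y - F x - (y - x)| <= 2^-1 * `|y - x|.

(** Gives the injectivity of [F] on the ball and a Lipschitz bound for its inverse. *)
Lemma near_id_expand x y : `|x - q| <= rho -> `|y - q| <= rho ->
  `|y - x| <= 2 * `|F y - F x|.
Proof.
move=> xq yq; have h := F_near_id xq yq.
have : `|y - x| <= `|F y - F x| + `|F y - F x - (y - x)|.
  by rewrite -{1}[y - x](subKr (F y - F x)) ler_normB.
by lra.
Qed.

(** The solutions of [F x = c] are the fixed points of [T x = x - F x + c]. This map contracts by
    1/2, and it preserves the ball because it moves the center [q] by [c - F q], of norm at most
    [rho / 2]. *)
Lemma near_id_surj c : `|c - F q| <= rho / 2 ->
  exists2 x, `|x - q| <= rho & F x = c.
Proof.
move=> cq; pose U := [set x : 'rV[R]_m | `|x - q| <= rho].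
pose T x : 'rV[R]_m := x - F x + c.
have TE x y : T y - T x = - (F y - F x - (y - x)).
  by rewrite /T; apply/rowP => i; rewrite !mxE; ring.
have qq : `|q - q| <= rho by rewrite subrr normr0 ltW.
have TU : set_fun U U T.
  move=> x Ux; rewrite /U /=.
  have -> : T x - q = T x - T q + (c - F q).
    by rewrite /T; apply/rowP => i; rewrite !mxE; ring.
  apply: le_trans (ler_normD _ _) _; rewrite TE normrN.
  have := F_near_id qq Ux; move: Ux; rewrite /U /=; lra.
pose f : {fun U >-> U} := HB.pack T (isFun.Build _ _ _ _ _ TU).
have ctr : is_contraction f.
  exists 2^-1%:nng; split => /=; first by lra.
  move=> -[x y] [/= Ux Uy].
  rewrite -[x - y]opprB normrN -normrN opprB TE normrN.
  exact: F_near_id.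
have clU : closed U.
  rewrite (_ : U = closed_ball q rho); first exact: closed_ball_closed.
  rewrite closed_ballE// /closed_ball_/=.
  by apply/seteqP; split => x; rewrite /U /= distrC.
have [|x Ux xE] := banach_fixed_point ctr clU; first by exists q.
exists x => //; move: xE; rewrite /= /T => /eqP; rewrite -subr_eq0 => /eqP xE.
apply/rowP => i; move/rowP: xE => /(_ i); rewrite !mxE; lra.
Qed.

End LocalInverse.

(** * A quantitative constant rank theorem *)

Section ConstantRank.
Variables (R : realType) (m k : nat).
Variables (h : 'rV[R]_m -> 'rV[R]_k) (J : 'rV[R]_m -> 'M[R]_(m, k)).
Variable q : 'rV[R]_m.

(** A quantitative form of [h] being continuously differentiable with differential [J]: the
    remainder is quadratic uniformly in the base point [x]. Vectors are rows, so differentials act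
    on the right. *)
Definition taylor_near := exists C rho : R, [/\ 0 < rho, 0 <= C &
  forall x y, `|x - q| <= rho -> `|y - q| <= rho ->
    `|h y - h x - (y - x) *m J x| <= C * `|y - x| ^+ 2].

Hypothesis hJ : taylor_near.

(* Comparing the expansions of h at q and at x along increments of the size of
   x - q shows that J is Lipschitz at q. *)
Lemma taylor_lipschitz : exists K rho : R, [/\ 0 < rho, 0 <= K &
  forall x (v : 'rV[R]_m), `|x - q| <= rho ->
    `|v *m (J x - J q)| <= K * `|x - q| * `|v|].
Proof.
have [C [rho [rho0 C0 H]]] := hJ.
(* The radius [rho / 2] keeps [x + u] in the ball of radius [rho]. The remainders of the three
   expansions are at most [C * s ^ 2], [4 * C * s ^ 2] and [C * s ^ 2], whence [6 * C]. *)
exists (6 * C), (rho / 2); split; [lra|lra|] => x v xq.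
have [->|v0] := eqVneq v 0; first by rewrite mul0mx !normr0 mulr0.
have [->|xq0] := eqVneq x q; first by rewrite !subrr mulmx0 !normr0 mulr0 mul0r.
set s := `|x - q| in xq *.
have s0 : 0 < s by rewrite normr_gt0 subr_eq0.
have vn0 : 0 < `|v| by rewrite normr_gt0.
pose u := (s / `|v|) *: v.
have us : `|u| = s.
  rewrite normrZ ger0_norm ?divr_ge0// ?ltW//.
  by rewrite -mulrA mulVf ?mulr1// gt_eqF.
have xr : `|x - q| <= rho by rewrite -/s; lra.
have xu : `|x + u - q| <= rho.
  have -> : x + u - q = (x - q) + u by rewrite addrAC.
  by apply: le_trans (ler_normD _ _) _; rewrite us -/s; lra.
have qr : `|q - q| <= rho by rewrite subrr normr0 ltW.
have a := H _ _ xr xu; have b := H _ _ qr xu; have c := H _ _ qr xr.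
have ux : x + u - x = u by rewrite addrC addKr.
have uq : `|x + u - q| <= 2 * s.
  have -> : x + u - q = (x - q) + u by rewrite addrAC.
  by apply: le_trans (ler_normD _ _) _; rewrite us -/s; lra.
rewrite ux us in a.
have E : u *m (J x - J q) = (h (x + u) - h q - (x + u - q) *m J q)
    - (h x - h q - (x - q) *m J q) - (h (x + u) - h x - u *m J x).
  rewrite mulmxBr (_ : x + u - q = (x - q) + u) ?mulmxDl;
    last by rewrite addrAC.
  move: (u *m J x) (u *m J q) ((x - q) *m J q) => ? ? ?.
  by apply/rowP => i; rewrite !mxE; ring.
have b' : C * `|x + u - q| ^+ 2 <= C * (2 * s) ^+ 2.
  by rewrite ler_wpM2l// ler_pXn2r// ?nnegrE// mulr_ge0// ltW.
have : `|u *m (J x - J q)| <= 6 * C * s ^+ 2.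
  rewrite E; apply: le_trans (ler_normB _ _) _.
  apply: le_trans (lerD (ler_normB _ _) (lexx _)) _.
  by move: a b b' c; rewrite -/s exprMn; lra.
rewrite -scalemxAl normrZ ger0_norm; last by rewrite divr_ge0// ltW.
move: (`|v *m _|) => z; rewrite [_ / _ * z]mulrAC ler_pdivrMr// => zs.
rewrite -(ler_pM2l s0); move: zs; rewrite -/s; lra.
Qed.

Section Submersion.
Variables (r : nat) (L : 'M[R]_(r, m)) (S : 'M[R]_(k, r)).
Hypothesis LJS : L *m J q *m S = 1%:M.

(** A change of coordinates that straightens [h *m S]: its differential at [q] is the identity, and
    by [F_S] it turns [h *m S] into the linear map [J q *m S], so fibers become pieces of affine
    subspaces. *)
Let F x := x + (h x *m S - x *m J q *m S) *m L.

Let F_S x : F x *m J q *m S = h x *m S.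
Proof.
have LJS' : L *m (J q *m S) = 1%:M by rewrite mulmxA.
rewrite -[LHS]mulmxA mulmxDl -(mulmxA (h x *m S - _)) LJS' mulmx1 mulmxA.
by rewrite addrC subrK.
Qed.

Let FE x y : F y - F x - (y - x) =
  (h y - h x - (y - x) *m J x) *m S *m L + (y - x) *m (J x - J q) *m S *m L.
Proof.
rewrite -!mulmxDl mulmxBr addrA subrK /F !mulmxBl.
rewrite -!mulmxA !mulmxA.
move: (h y *m S *m L) (h x *m S *m L) => a b.
move: (y *m J q *m S *m L) (x *m J q *m S *m L) => c d.
by apply/rowP => i; rewrite !mxE; ring.
Qed.

Let normSL : exists2 c : R, 0 < c &
  forall v : 'rV_k, `|v *m S *m L| <= c * `|v|.
Proof.
exists (r%:R * `|L| * (k%:R * `|S|) + 1).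
  by rewrite ltr_pwDr// !mulr_ge0.
move=> v; apply: le_trans (mx_norm_mulmx _ _) _.
apply: le_trans (ler_wpM2l _ (mx_norm_mulmx _ _)) _; first by rewrite mulr_ge0.
by rewrite [leLHS]mulrA; apply: ler_wpM2r => //; rewrite lerDl ler01.
Qed.

Let F_near_id : exists2 rho : R, 0 < rho & forall x y,
  `|x - q| <= rho -> `|y - q| <= rho ->
  `|F y - F x - (y - x)| <= 2^-1 * `|y - x|.
Proof.
have [C [rho [rho0 C0 H]]] := hJ.
have [K [rho' [rho'0 K0 H']]] := taylor_lipschitz.
have [c c0 Hc] := normSL.
(* On a ball of radius [r] one has [|y - x| <= 2 * r], so by [FE] the Lipschitz constant of [F - id]
   is at most [c * (2 * C + K) * r], which is below 1/2 for [r = 2^-1 / d]. *)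
pose d := c * (2 * C + K) + 1.
have d0 : 0 < d by rewrite /d ltr_pwDr// mulr_ge0//; lra.
exists (Num.min (Num.min rho rho') (2^-1 / d)).
  by rewrite !lt_min rho0 rho'0 divr_gt0.
move=> x y; rewrite !le_min => /andP[/andP[x1 x2] x3] /andP[/andP[y1 y2] y3].
rewrite FE; apply: le_trans (ler_normD _ _) _.
have a := le_trans (Hc _) (ler_wpM2l (ltW c0) (H _ _ x1 y1)).
have b := le_trans (Hc _) (ler_wpM2l (ltW c0) (H' _ (y - x) x2)).
have e : `|y - x| <= 2 * (2^-1 / d).
  have -> : y - x = (y - q) - (x - q) by rewrite opprB addrA subrK.
  by apply: le_trans (ler_normB _ _) _; lra.
apply: le_trans (lerD a b) _.
have -> : c * (C * `|y - x| ^+ 2) + c * (K * `|x - q| * `|y - x|) =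
  c * (C * `|y - x| + K * `|x - q|) * `|y - x| by ring.
apply: ler_wpM2r => //.
have e1 : C * `|y - x| <= C * (2 * (2^-1 / d)) by exact: ler_wpM2l.
have e2 : K * `|x - q| <= K * (2^-1 / d) by exact: ler_wpM2l.
apply: (@le_trans _ _ (c * (C * (2 * (2^-1 / d)) + K * (2^-1 / d)))).
  by apply: ler_wpM2l; [exact: ltW|lra].
have -> : c * (C * (2 * (2^-1 / d)) + K * (2^-1 / d)) = (2^-1 / d) * (d - 1).
  by rewrite /d; ring.
by rewrite mulrAC ler_pdivrMr//; lra.
Qed.

(* The tangent direction v is followed up to second order by a curve in the
   fiber of h *m S through q. *)
Lemma fiber_curve (v : 'rV[R]_m) : v *m J q *m S = 0 ->
  exists K d : R, [/\ 0 < d, 0 <= K & forall t, `|t| <= d ->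
    exists x, [/\ h x *m S = h q *m S, `|x - q| <= K * `|t| &
      `|x - q - t *: v| <= K * t ^+ 2]].
Proof.
move=> vS.
have [C [rho [rho0 C0 H]]] := hJ.
have [rho' rho'0 H'] := F_near_id.
have [c c0 Hc] := normSL.
pose rh := Num.min rho rho'.
have rh0 : 0 < rh by rewrite lt_min rho0.
have Hrh x y : `|x - q| <= rh -> `|y - q| <= rh ->
    `|F y - F x - (y - x)| <= 2^-1 * `|y - x|.
  by rewrite !le_min => /andP[_ ?] /andP[_ ?]; exact: H'.
pose a := `|v| + 1.
have a0 : 0 < a by rewrite /a ltr_pwDr.
pose K := 2 * a + c * C * (2 * a) ^+ 2.
have cC : 0 <= c * C * (2 * a) ^+ 2 by rewrite !mulr_ge0// ltW.
have qq : `|q - q| <= rh by rewrite subrr normr0 ltW.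
exists K, (rh / 2 / a); split; first by rewrite !divr_gt0.
  by rewrite /K; lra.
move=> t td.
have ta : `|t| * a <= rh / 2 by rewrite -ler_pdivlMr.
have tv : `|t *: v| <= `|t| * a by rewrite normrZ ler_wpM2l// /a lerDl.
have [|x xq Fx] := near_id_surj rh0 Hrh (c := F q + t *: v).
  by rewrite addrC addKr; exact: le_trans tv ta.
have xq2 : `|x - q| <= 2 * a * `|t|.
  have := near_id_expand Hrh qq xq; rewrite Fx [F q + _]addrC addrK.
  by move: tv; rewrite -mulrA [a * _]mulrC; lra.
exists x; split.
- by rewrite -!F_S Fx !mulmxDl -!scalemxAl vS scaler0 addr0.
- by apply: le_trans xq2 _; apply: ler_wpM2r => //; rewrite /K lerDl.
(* At the base point [q] the term of [FE] in [J x - J q] vanishes, so [x - q] differs from [t *: v]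
   by a Taylor remainder only. *)
have := FE q x; rewrite Fx [F q + _]addrC addrK subrr mulmx0 !mul0mx addr0 => E.
rewrite -normrN opprB E; apply: le_trans (Hc _) _.
apply: le_trans (ler_wpM2l (ltW c0) (H _ _ _ _)) _.
- by rewrite subrr normr0 ltW.
- by move: xq; rewrite le_min => /andP[].
have e : `|x - q| ^+ 2 <= (2 * a * `|t|) ^+ 2.
  by rewrite ler_pXn2r// nnegrE// !mulr_ge0// ltW.
apply: (@le_trans _ _ (c * C * (2 * a * `|t|) ^+ 2)).
  by rewrite -[leRHS]mulrA; apply: ler_wpM2l; [exact: ltW|exact: ler_wpM2l].
rewrite exprMn mulrA real_normK ?num_real//.
by apply: ler_wpM2r; [exact: sqr_ge0|rewrite /K lerDr; lra].
Qed.

Hypothesis rankJ : exists2 rho : R, 0 < rho & forall x, `|x - q| <= rho ->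
  (\rank (J x) <= r)%N.

(** Near [q] the matrix [J x *m S] still has rank [r], at least the rank of [J x], so [J x] factors
    through it. Between two points of a fiber, [(y - x) *m J x *m S] is a Taylor remainder, hence
    quadratic in [y - x]; then so are [(y - x) *m J x] and [h y - h x]. *)
Let fiber_quadratic : exists K rho : R, [/\ 0 < rho, 0 <= K & forall x y,
  `|x - q| <= rho -> `|y - q| <= rho -> h x *m S = h y *m S ->
  `|h y - h x| <= K * `|y - x| ^+ 2].
Proof.
have [C [rho [rho0 C0 H]]] := hJ.
have [K [rho' [rho'0 K0 H']]] := taylor_lipschitz.
have [rho'' rho''0 rJ] := rankJ.
pose cL := r%:R * `|L|.
pose cS := k%:R * `|S|.
have cL0 : 0 <= cL by rewrite mulr_ge0.
have cS0 : 0 <= cS by rewrite mulr_ge0.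
pose d := cS * K * cL + 1.
have d0 : 0 < d by rewrite /d ltr_pwDr// !mulr_ge0.
pose rh := Num.min (Num.min rho rho') (Num.min rho'' (2^-1 / d)).
pose M := K * rh * cL + m%:R * `|J q| * cL.
have rh0 : 0 < rh by rewrite !lt_min rho0 rho'0 rho''0 divr_gt0.
have M0 : 0 <= M by rewrite addr_ge0 ?mulr_ge0// ltW.
exists (C + 2 * M * (cS * C)), rh; split => //.
  by rewrite addr_ge0// !mulr_ge0.
move=> x y xr yr hS.
have /andP[/andP[x1 x2] /andP[x3 x4]] :
  (`|x - q| <= rho) && (`|x - q| <= rho') &&
  ((`|x - q| <= rho'') && (`|x - q| <= 2^-1 / d)) by rewrite -!le_min.
have y1 : `|y - q| <= rho by move: yr; rewrite !le_min => /andP[/andP[]].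
(* By [LJS] this is the identity at [x = q]; the radius [2^-1 / d] keeps it within 1/2 of the
   identity, hence invertible with an inverse bounded by 2. *)
pose Q := L *m (J x *m S).
have Qu (u : 'rV_r) : `|u| <= 2 * `|u *m Q|.
  have : `|u *m Q - u| <= 2^-1 * `|u|.
    have -> : u *m Q - u = u *m L *m (J x - J q) *m S.
      rewrite /Q -[u in _ - u]mulmx1 -LJS -!mulmxA -mulmxBr; congr (u *m _).
      by rewrite -mulmxBr mulmxBl.
    apply: le_trans (mx_norm_mulmx _ _) _; rewrite -/cS.
    apply: le_trans (ler_wpM2l cS0 (H' _ _ x2)) _.
    apply: (@le_trans _ _ (cS * (K * (2^-1 / d) * (cL * `|u|)))).
      apply: ler_wpM2l => //; apply: ler_pM => //; first by rewrite mulr_ge0.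
        by apply: ler_wpM2l.
      exact: mx_norm_mulmx.
    rewrite [leLHS](_ : _ = 2^-1 * `|u| * ((d - 1) / d));
      last by rewrite /d; ring.
    by rewrite ler_piMr ?mulr_ge0// ler_pdivrMr//; lra.
  have : `|u| <= `|u *m Q| + `|u *m Q - u|.
    by rewrite -{1}[u](subKr (u *m Q)) ler_normB.
  by lra.
have Q1 : Q \in unitmx.
  rewrite -row_free_unit -kermx_eq0; apply/eqP/row_matrixP => i.
  apply/eqP; rewrite row0 -normr_le0.
  by apply: le_trans (Qu _) _; rewrite -row_mul mulmx_ker row0 normr0 mulr0.
have sub : ((J x *m S)^T <= (J x)^T)%MS by rewrite trmx_mul submxMl.
have rS : \rank (J x *m S)^T = r.
  apply/eqP; rewrite eqn_leq rank_leq_row /=.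
  move: Q1; rewrite -row_free_unit /row_free => /eqP {1}<-.
  by rewrite mxrank_tr; exact: mxrankM_maxr.
have /submxP[T /(congr1 trmx)] : ((J x)^T <= (J x *m S)^T)%MS.
  by rewrite -(geq_leqif (mxrank_leqif_sup sub)) rS mxrank_tr; exact: rJ.
rewrite trmxK trmx_mul trmxK => JE.
(* Multiplying [J x = J x *m S *m T^T] by [L] on the left determines [T^T] through [Q], which makes
   the factorization bounded uniformly in [x]. *)
have JE2 : J x = J x *m S *m invmx Q *m L *m J x.
  have QT : Q *m T^T = L *m J x by rewrite [in RHS]JE /Q !mulmxA.
  have TE : T^T = invmx Q *m (L *m J x) by rewrite -QT mulKmx.
  by rewrite {1}JE TE !mulmxA.
have B : `|h y - h x - (y - x) *m J x| <= C * `|y - x| ^+ 2 by exact: H.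
have B1 : `|(y - x) *m J x *m S| <= cS * (C * `|y - x| ^+ 2).
  have -> : (y - x) *m J x *m S = - ((h y - h x - (y - x) *m J x) *m S).
    by rewrite [in RHS]mulmxBl (mulmxBl (h y)) hS subrr sub0r opprK.
  rewrite normrN; apply: le_trans (mx_norm_mulmx _ _) _.
  exact: ler_wpM2l.
have B2 (w : 'rV_r) : `|w *m L *m J x| <= M * `|w|.
  have -> : w *m L *m J x = w *m L *m (J x - J q) + w *m L *m J q.
    by rewrite mulmxBr subrK.
  apply: le_trans (ler_normD _ _) _.
  rewrite /M mulrDl; apply: lerD.
    apply: le_trans (H' _ _ x2) _; rewrite -mulrA.
    rewrite -!mulrA; apply: ler_wpM2l => //; apply: ler_pM => //.
    by rewrite mulrA; exact: mx_norm_mulmx.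
  apply: le_trans (mx_norm_mulmx _ _) _; rewrite -[leRHS]mulrA.
  by apply: ler_wpM2l (mx_norm_mulmx _ _); rewrite mulr_ge0.
have B3 : `|(y - x) *m J x| <= 2 * M * (cS * C) * `|y - x| ^+ 2.
  rewrite JE2 !mulmxA; apply: le_trans (B2 _) _.
  apply: le_trans (ler_wpM2l M0 (Qu _)) _.
  rewrite mulmxKV// mulrA [M * 2]mulrC -[leRHS]mulrA.
  by apply: ler_wpM2l; [rewrite mulr_ge0|rewrite -mulrA].
rewrite -[h y - h x](subrK ((y - x) *m J x)).
by apply: le_trans (ler_normD _ _) _; rewrite mulrDl; exact: lerD.
Qed.

(* A point y of the fiber is joined to q by N steps of length O(1/N) inside the
   fiber, and h moves by O(1/N^2) in each of them. *)
Lemma constant_rank_fiber : exists2 d : R, 0 < d & forall y, `|y - q| <= d ->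
  h y *m S = h q *m S -> h y = h q.
Proof.
have [rho rho0 H] := F_near_id.
have [K [rho' [rho'0 K0 H']]] := fiber_quadratic.
pose rh := Num.min rho rho'.
have rh0 : 0 < rh by rewrite lt_min rho0.
have Hrh x y : `|x - q| <= rh -> `|y - q| <= rh ->
    `|F y - F x - (y - x)| <= 2^-1 * `|y - x|.
  by rewrite !le_min => /andP[? _] /andP[? _]; exact: H.
have qq : `|q - q| <= rh by rewrite subrr normr0 ltW.
(* Then [|w| <= 3 / 2 * |y - q|] stays below [rh / 2], the reach of [near_id_surj]. *)
exists (rh / 4); first by lra.
move=> y yq hS.
have yq' : `|y - q| <= rh by lra.
pose w := F y - F q.
(* By [F_S], the points that [F] maps into the segment from [F q] to [F y] thus all lie in the fiber
   of [q]. *)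
have wS : w *m J q *m S = 0 by rewrite /w !mulmxBl !F_S hS subrr.
have wn : `|w| <= rh / 2.
  have : `|w| <= `|F y - F q - (y - q)| + `|y - q|.
    by rewrite -{1}[w](subrK (y - q)) ler_normD.
  by have := Hrh _ _ qq yq'; lra.
(* The path [g] joining [q] to [y] is the preimage of this segment under [F]. The condition on [t]
   stands under the quantifier so that [choice] yields a total function. *)
have ex t : exists x, 0 <= t <= 1 -> `|x - q| <= rh /\ F x = F q + t *: w.
  have [t01|] := boolP (0 <= t <= 1); last by exists q.
  have [|x xq Fx] := near_id_surj rh0 Hrh (c := F q + t *: w); last by exists x.
  rewrite addrC addKr normrZ; apply: le_trans wn.
  by case/andP: t01 => t0 t1; rewrite ler_piMl// ger0_norm.
have [g gP] := choice ex.
have inj x z : `|x - q| <= rh -> `|z - q| <= rh -> F x = F z -> x = z.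
  move=> xr zr Fxz; have := near_id_expand Hrh xr zr.
  rewrite Fxz subrr normr0 mulr0 normr_le0 subr_eq0 => /eqP //.
have g0 : g 0 = q.
  have [|a b] := gP 0; first by rewrite lexx ler01.
  by apply: inj => //; rewrite b scale0r addr0.
have g1 : g 1 = y.
  have [|a b] := gP 1; first by rewrite lexx ler01.
  by apply: inj => //; rewrite b scale1r /w addrC subrK.
have gS t : 0 <= t <= 1 -> h (g t) *m S = h q *m S.
  move=> /gP[_ Ft]; rewrite -F_S Ft (mulmxDl (F q)) (mulmxDl (F q *m _)).
  by rewrite -!scalemxAl wS scaler0 addr0 F_S.
have step s t : 0 <= s <= 1 -> 0 <= t <= 1 ->
    `|h (g t) - h (g s)| <= K * (2 * `|w|) ^+ 2 * (t - s) ^+ 2.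
  move=> s01 t01; have [a b] := gP _ s01; have [a' b'] := gP _ t01.
  have le2 z : `|z - q| <= rh -> `|z - q| <= rho' by rewrite le_min => /andP[].
  have := H' _ _ (le2 _ a) (le2 _ a'); rewrite !gS// => /(_ erefl).
  move=> /le_trans; apply.
  rewrite -mulrA; apply: ler_wpM2l => //.
  rewrite -[(t - s) ^+ 2]real_normK ?num_real// -exprMn.
  rewrite ler_pXn2r// ?nnegrE ?mulr_ge0//.
  have := near_id_expand Hrh a a'; rewrite b b' => /le_trans; apply.
  have -> : F q + t *: w - (F q + s *: w) = (t - s) *: w.
    by rewrite scalerBl; apply/rowP => i; rewrite !mxE; ring.
  by rewrite normrZ -mulrA [`|w| * _]mulrC.
pose c := K * (2 * `|w|) ^+ 2.
have c0 : 0 <= c by rewrite mulr_ge0// sqr_ge0.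
have bound (N : nat) : `|h y - h q| <= c / N.+1%:R.
  have N0 : 0 < N.+1%:R :> R by rewrite ltr0n.
  have in01 i : (i <= N.+1)%N -> 0 <= (i%:R / N.+1%:R : R) <= 1.
    by move=> iN; rewrite divr_ge0// ler_pdivrMr// mul1r ler_nat.
  have ind i : (i <= N.+1)%N ->
      `|h (g (i%:R / N.+1%:R)) - h q| <= i%:R * (c / N.+1%:R ^+ 2).
    elim: i => [|i IH] iN; first by rewrite mul0r g0 subrr normr0 mul0r.
    have -> : h (g (i.+1%:R / N.+1%:R)) - h q =
       (h (g (i.+1%:R / N.+1%:R)) - h (g (i%:R / N.+1%:R))) +
       (h (g (i%:R / N.+1%:R)) - h q) by rewrite addrA subrK.
    apply: le_trans (ler_normD _ _) _.
    have -> : i.+1%:R * (c / N.+1%:R ^+ 2) =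
        c / N.+1%:R ^+ 2 + i%:R * (c / N.+1%:R ^+ 2).
      by rewrite -(natr1 i) mulrDl mul1r addrC.
    apply: lerD (IH (ltnW iN)).
    apply: le_trans (step _ _ (in01 _ (ltnW iN)) (in01 _ iN)) _.
    by rewrite -mulrBl -(natr1 i) [i%:R + 1]addrC addrK mul1r exprVn.
  have := ind N.+1 (leqnn _); rewrite divff ?gt_eqF// g1 => /le_trans; apply.
  by rewrite expr2 invfM mulrCA !mulrA mulfK ?gt_eqF.
apply/eqP; rewrite -subr_eq0 -normr_le0 leNgt; apply/negP => n0.
have [N _ /(_ N (leqnn _))] := near_infty_natSinv_lt
  (PosNum (divr_gt0 n0 (ltr_pwDr ltr01 c0))).
rewrite /= ltr_pdivlMr ?ltr_pwDr// => e.
have := bound N; rewrite leNgt => /negP; apply.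
apply: le_lt_trans e; rewrite mulrC ler_wpM2l ?invr_ge0//; lra.
Qed.

End Submersion.
End ConstantRank.

(** Gaussian elimination writes [A] as [pid_mx (\rank A)] between two invertible matrices; inverting
    these and keeping the identity block gives [L] and [S]. It supplies the hypothesis [LJS] of the
    constant rank theorem. *)
Lemma rank_factor (F : fieldType) m k (A : 'M[F]_(m, k)) :
  exists (L : 'M[F]_(\rank A, m)) (S : 'M[F]_(k, \rank A)), L *m A *m S = 1%:M.
Proof.
exists (pid_mx (\rank A) *m invmx (col_ebase A)).
exists (invmx (row_ebase A) *m pid_mx (\rank A)).
have E : invmx (col_ebase A) *m A = pid_mx (\rank A) *m row_ebase A.
  rewrite -[RHS](mulKmx (col_ebase_unit A)) (mulmxA (col_ebase A)).
  by rewrite mulmx_ebase.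
rewrite -mulmxA -mulmxA (mulmxA (invmx _)) E -mulmxA.
rewrite (mulKVmx (row_ebase_unit A)) !pid_mx_id ?rank_leq_row ?rank_leq_col//.
exact: pid_mx_1.
Qed.

(** * Ranks of polynomial matrices at generic points *)

Section GenericRank.
Variables (R : realType) (m : nat).
Implicit Types x p : 'rV[R]_m.

Definition mpoly_ev x : {rmorphism mpoly m int -> R} :=
  mmap (intr : int -> R) (fun i => x 0 i).

Definition mpoly_generic p :=
  forall P : mpoly m int, P != 0 -> mpoly_ev p P != 0.

(* A minor that does not vanish at x is a nonzero polynomial, so it does not
   vanish at p either. *)
Lemma mpoly_generic_rank a b (M : 'M[mpoly m int]_(a, b)) x p :
  mpoly_generic p ->
  (\rank (map_mx (mpoly_ev x) M) <= \rank (map_mx (mpoly_ev p) M))%N.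
Proof.
move=> gp; set A := map_mx _ M.
have fA : row_full (rowsub (maxrankfun A) A)^T.
  rewrite /row_full mxrank_tr.
  by rewrite (eqP (maxrowsub_free A)).
(* [f] picks a maximal set of independent rows of [A], and [g] as many independent columns of these
   rows; [N] is the transpose of the resulting square submatrix of [M]. *)
set f := maxrankfun A in fA; pose g := fullrankfun fA.
pose N := \matrix_(i, j) M (f j) (g i).
have NE y : map_mx (mpoly_ev y) N =
    rowsub g (rowsub f (map_mx (mpoly_ev y) M))^T.
  by apply/matrixP => i j; rewrite !mxE.
have Nx := fullrowsub_unit fA; rewrite -/g -NE unitmxE det_map_mx unitfE in Nx.
have Np : map_mx (mpoly_ev p) N \in unitmx.
  rewrite unitmxE det_map_mx unitfE; apply: gp.
  by apply: contraNneq Nx => ->; rewrite rmorph0.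
rewrite -[leqLHS](mxrank_unit Np) NE.
apply: leq_trans (mxrankS (rowsub_sub _ _)) _.
by rewrite mxrank_tr; exact: mxrankS (rowsub_sub _ _).
Qed.
End GenericRank.

(** * The constraints as quotients of integer quadratic forms *)

Section Constraints.
Variable n : nat.

(* inl (r, s, t) stands for the angle at r from s to t, inr (i, j, k) for the
   ratio of distances from i to k and to j. *)
Definition constraint := ('I_n * 'I_n * 'I_n + 'I_n * 'I_n * 'I_n)%type.

(** The two outer vertices may coincide: the denominator of [inr (i, j, j)] is the squared distance
    from [i] to [j], which serves to keep points distinct. *)
Definition well_formed (t : constraint) : bool :=
  match t with inl x | inr x => (x.1.1 != x.1.2) && (x.1.1 != x.2) end.

Section Forms.
Variable S : comNzRingType.
Implicit Types x y v : 'rV[S]_(n * 2).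

(** The forms are defined over any commutative ring, to be read both over integer polynomials and
    over the reals. They are polarized, with arguments [x] and [y], so that derivatives are given by
    the same forms. *)
Definition edge_coord x i j (c : 'I_2) : S :=
  x 0 (mxvec_index j c) - x 0 (mxvec_index i c).

Definition edge_dot x y i j k : S :=
  edge_coord x i j 0 * edge_coord y i k 0 +
  edge_coord x i j 1 * edge_coord y i k 1.

Definition edge_cross x y i j k : S :=
  edge_coord x i j 0 * edge_coord y i k 1 -
  edge_coord x i j 1 * edge_coord y i k 0.

(* The constraint functions are the quotients of the quadratic forms of cnum
   and cden: the tangent of an angle, and the square of a ratio. *)
Definition cnum (t : constraint) x y : S :=
  match t with
  | inl z => edge_cross x y z.1.1 z.1.2 z.2
  | inr z => edge_dot x y z.1.1 z.2 z.2
  end.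

Definition cden (t : constraint) x y : S :=
  match t with
  | inl z => edge_dot x y z.1.1 z.1.2 z.2
  | inr z => edge_dot x y z.1.1 z.1.2 z.1.2
  end.

(* The numerator of the derivative of cnum / cden. *)
Definition cdiff (t : constraint) x v : S :=
  cden t x x * (cnum t x v + cnum t v x) -
  cnum t x x * (cden t x v + cden t v x).

Lemma edge_coordD x y i j c :
  edge_coord (x + y) i j c = edge_coord x i j c + edge_coord y i j c.
Proof. by rewrite /edge_coord !mxE; ring. Qed.

Lemma edge_coordZ a x i j c :
  edge_coord (a *: x) i j c = a * edge_coord x i j c.
Proof. by rewrite /edge_coord !mxE; ring. Qed.

Lemma cnumD t x v :
  cnum t (x + v) (x + v) = cnum t x x + (cnum t x v + cnum t v x) + cnum t v v.
Proof.
by case: t => z /=; rewrite /edge_cross /edge_dot !edge_coordD; ring.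
Qed.

Lemma cdenD t x v :
  cden t (x + v) (x + v) = cden t x x + (cden t x v + cden t v x) + cden t v v.
Proof.
by case: t => z /=; rewrite /edge_cross /edge_dot !edge_coordD; ring.
Qed.

Lemma cdiff_is_scalar t x : scalar (cdiff t x).
Proof.
move=> a u v; rewrite /cdiff; case: t => z /=;
by rewrite /edge_cross /edge_dot !(edge_coordD, edge_coordZ); ring.
Qed.

HB.instance Definition _ t x :=
  GRing.isLinear.Build S 'rV[S]_(n * 2) S *%R (cdiff t x) (cdiff_is_scalar t x).

Definition cjacobian k (tt : 'I_k -> constraint) x : 'M[S]_(n * 2, k) :=
  \matrix_(l, i) cdiff (tt i) x (delta_mx 0 l).

Lemma mul_cjacobian k (tt : 'I_k -> constraint) x v i :
  (v *m cjacobian tt x) 0 i = cdiff (tt i) x v.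
Proof.
rewrite [in RHS](row_sum_delta v) linear_sum mxE; apply: eq_bigr => l _.
by rewrite linearZ mxE.
Qed.

End Forms.

Section Morphism.
Variables (S S' : comNzRingType) (f : {rmorphism S -> S'}).
Implicit Types x y v : 'rV[S]_(n * 2).

Lemma rmorph_edge_coord x i j c :
  f (edge_coord x i j c) = edge_coord (map_mx f x) i j c.
Proof. by rewrite /edge_coord !mxE rmorphB. Qed.

Lemma rmorph_edge_dot x y i j k :
  f (edge_dot x y i j k) = edge_dot (map_mx f x) (map_mx f y) i j k.
Proof. by rewrite /edge_dot rmorphD !rmorphM !rmorph_edge_coord. Qed.

Lemma rmorph_edge_cross x y i j k :
  f (edge_cross x y i j k) = edge_cross (map_mx f x) (map_mx f y) i j k.
Proof. by rewrite /edge_cross rmorphB !rmorphM !rmorph_edge_coord. Qed.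

Lemma rmorph_cden t x y : f (cden t x y) = cden t (map_mx f x) (map_mx f y).
Proof. by case: t => z; exact: rmorph_edge_dot. Qed.

Lemma rmorph_cnum t x y : f (cnum t x y) = cnum t (map_mx f x) (map_mx f y).
Proof.
by case: t => z; [exact: rmorph_edge_cross|exact: rmorph_edge_dot].
Qed.

Lemma map_cjacobian k (tt : 'I_k -> constraint) x :
  map_mx f (cjacobian tt x) = cjacobian tt (map_mx f x).
Proof.
apply/matrixP => l i; rewrite !mxE /cdiff rmorphB !rmorphM !rmorphD.
by rewrite !rmorph_cden !rmorph_cnum map_delta_mx.
Qed.

End Morphism.

Section Generic.
Variable R : realType.
Implicit Types x p : 'rV[R]_(n * 2).

(** The universal configuration, whose coordinates are the indeterminates. *)
Let X : 'rV[mpoly (n * 2)%N int]_(n * 2) := \row_l mpolyX int (mnm1 l).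

Let map_X x : map_mx (mpoly_ev x) X = x.
Proof. by apply/rowP => l; rewrite !mxE /= mmapX mmap1U. Qed.

(** The product with [B] is the value of a matrix of integer polynomials. In the applications [B] is
    the identity or a diagonal matrix that selects constraints. *)
Lemma generic_cjacobian_rank k k' (tt : 'I_k -> constraint)
    (B : 'M[int]_(k, k')) x p : mpoly_generic p ->
  (\rank (cjacobian tt x *m map_mx intr B) <=
   \rank (cjacobian tt p *m map_mx intr B))%N.
Proof.
have E (y : 'rV[R]_(n * 2)) : cjacobian tt y *m map_mx intr B =
    map_mx (mpoly_ev y) (cjacobian tt X *m map_mx intr B).
  rewrite map_mxM map_cjacobian map_X; congr (_ *m _).
  by apply/matrixP => i j; rewrite !mxE rmorph_int.
by move=> gp; rewrite !E; exact: mpoly_generic_rank.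
Qed.

Lemma generic_cden_neq0 t p : mpoly_generic p -> well_formed t ->
  cden t p p != 0.
Proof.
move=> gp tn; rewrite -(map_X p) -rmorph_cden; apply: gp.
(* It suffices to find one configuration where the denominator is nonzero: with vertex [r] at the
   origin and all others at [(1, 0)], the denominators with apex [r] equal 1. *)
pose a r : 'rV[R]_(n * 2) := mxvec (\matrix_(i, c) ((i != r) && (c == 0))%:R).
pose r := match t with inl z | inr z => z.1.1 end.
have : mpoly_ev (a r) (cden t X X) != 0.
  rewrite rmorph_cden map_X /r /a; case: t tn {r} => -[[i j] l] /= /andP[ij il];
  rewrite /edge_dot /edge_coord !mxvecE !mxE !eqxx /=;
  by rewrite ![_ == i]eq_sym ?ij ?il /= subr0 mulr1 subrr mulr0 addr0 oner_neq0.
by apply: contra_neq => ->; rewrite rmorph0.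
Qed.

End Generic.
End Constraints.

(** * Taylor estimates for the constraint functions *)

Section ConstraintAnalysis.
Variables (R : realType) (n : nat).
Implicit Types (t : constraint n) (x y v q : 'rV[R]_(n * 2)).

Lemma le_edge_coord x i j c : `|edge_coord x i j c| <= 2 * `|x|.
Proof.
apply: le_trans (ler_normB _ _) _.
have := le_mx_norm x 0 (mxvec_index j c).
have := le_mx_norm x 0 (mxvec_index i c).
by rewrite mulr_natl mulr2n; lra.
Qed.

Let le_coordM x y i j k c d :
  `|edge_coord x i j c * edge_coord y i k d| <= 4 * (`|x| * `|y|).
Proof.
rewrite normrM [leRHS](_ : _ = 2 * `|x| * (2 * `|y|)); last by ring.
by apply: ler_pM => //; exact: le_edge_coord.
Qed.

Let le_edge_dot x y i j k : `|edge_dot x y i j k| <= 8 * (`|x| * `|y|).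
Proof.
apply: le_trans (ler_normD _ _) _.
have := le_coordM x y i j k 0 0; have := le_coordM x y i j k 1 1; lra.
Qed.

Let le_edge_cross x y i j k : `|edge_cross x y i j k| <= 8 * (`|x| * `|y|).
Proof.
apply: le_trans (ler_normB _ _) _.
have := le_coordM x y i j k 0 1; have := le_coordM x y i j k 1 0; lra.
Qed.

Lemma le_cnum t x y : `|cnum t x y| <= 8 * (`|x| * `|y|).
Proof. by case: t => z; [exact: le_edge_cross|exact: le_edge_dot]. Qed.

Lemma le_cden t x y : `|cden t x y| <= 8 * (`|x| * `|y|).
Proof. by case: t => z; exact: le_edge_dot. Qed.

Lemma cden_near q t : cden t q q != 0 -> exists2 rho, 0 < rho &
  forall x, `|x - q| <= rho -> `|cden t x x - cden t q q| <= `|cden t q q| / 2.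
Proof.
move=> q0; set e := `|cden t q q| / 2.
have e0 : 0 < e by rewrite divr_gt0// normr_gt0.
(* The two mixed terms of [cdenD] are at most [8 * |q| * |v|] each, and the quadratic one at most
   [8 * |v|] since [|v| <= 1]. *)
pose M := 16 * `|q| + 8.
have M0 : 0 < M by rewrite /M ltr_wpDl// mulr_ge0.
exists (Num.min 1 (e / M)); first by rewrite lt_min ltr01 divr_gt0.
move=> x; rewrite le_min => /andP[x1 xe].
move: x1 xe; set v := x - q => v1 ve.
have -> : x = q + v by rewrite /v addrC subrK.
rewrite cdenD -[_ + cden t v v]addrA addrAC subrr add0r.
have v0 : 0 <= `|v| by [].
apply: (@le_trans _ _ (M * `|v|)); last by rewrite mulrC -ler_pdivlMr.
apply: le_trans (ler_normD _ _) _.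
apply: le_trans (lerD (ler_normD _ _) (lexx _)) _.
have := le_cden t q v; have := le_cden t v q; have := le_cden t v v.
have : `|v| * `|v| <= `|v| by rewrite ler_piMr.
rewrite /M; lra.
Qed.

(** Here [n0], [n1], [n2] and [d0], [d1], [d2] are the parts of degree 0, 1, 2 in an increment of
    size [s]. Over a common denominator, every product left in the remainder has order at least 2 in
    [s]; the two groups of products contribute [2 * M ^ 3] and [4 * M ^ 3]. *)
Lemma quotient_taylor (M d s n0 n1 n2 d0 d1 d2 : R) :
  0 <= s -> 0 < d -> 0 <= M ->
  `|n0| <= M -> `|d0| <= M -> `|n1| <= M * s -> `|d1| <= M * s ->
  `|n2| <= M * s ^+ 2 -> `|d2| <= M * s ^+ 2 -> `|d2| <= M * s ->
  d <= `|d0| -> d <= `|d0 + d1 + d2| ->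
  `|(n0 + n1 + n2) / (d0 + d1 + d2) - n0 / d0 - (d0 * n1 - n0 * d1) / d0 ^+ 2|
    <= 6 * M ^+ 3 / d ^+ 3 * s ^+ 2.
Proof.
move=> s0 dp M0 n0M d0M n1M d1M n2M d2M d2M' dd0 dd.
have z0 : d0 != 0 by rewrite -normr_gt0; exact: lt_le_trans dd0.
have z : d0 + d1 + d2 != 0 by rewrite -normr_gt0; exact: lt_le_trans dd.
have -> : (n0 + n1 + n2) / (d0 + d1 + d2) - n0 / d0 -
    (d0 * n1 - n0 * d1) / d0 ^+ 2 =
  ((n2 * d0 - n0 * d2) * d0 - (d0 * n1 - n0 * d1) * (d1 + d2)) /
    (d0 ^+ 2 * (d0 + d1 + d2)) by field; rewrite z z0.
rewrite normrM normfV.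
have D : d ^+ 3 <= `|d0 ^+ 2 * (d0 + d1 + d2)|.
  rewrite normrM normrX exprSr.
  apply: ler_pM => //; [exact: sqr_ge0|exact: ltW|].
  by rewrite ler_pXn2r ?nnegrE// ltW.
have N : `|(n2 * d0 - n0 * d2) * d0 - (d0 * n1 - n0 * d1) * (d1 + d2)| <=
    6 * M ^+ 3 * s ^+ 2.
  have le2 (a b A B : R) : `|a| <= A -> `|b| <= B -> `|a * b| <= A * B.
    by move=> ? ?; rewrite normrM ler_pM.
  have leB (a b A B : R) : `|a| <= A -> `|b| <= B -> `|a - b| <= A + B :> R.
    by move=> ? ?; apply: le_trans (ler_normB _ _) _; exact: lerD.
  have leD (a b A B : R) : `|a| <= A -> `|b| <= B -> `|a + b| <= A + B :> R.
    by move=> ? ?; apply: le_trans (ler_normD _ _) _; exact: lerD.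
  have a := le2 _ _ _ _ (leB _ _ _ _ (le2 _ _ _ _ n2M d0M)
    (le2 _ _ _ _ n0M d2M)) d0M.
  have b := le2 _ _ _ _ (leB _ _ _ _ (le2 _ _ _ _ d0M n1M)
    (le2 _ _ _ _ n0M d1M)) (leD _ _ _ _ d1M d2M').
  apply: le_trans (leB _ _ _ _ a b) _.
  by rewrite le_eqVlt; apply/orP; left; apply/eqP; ring.
rewrite [leRHS]mulrAC; apply: ler_pM => //.
rewrite lef_pV2// posrE ?exprn_gt0//.
by apply: lt_le_trans D; rewrite exprn_gt0.
Qed.

Lemma constraint_taylor t q : cden t q q != 0 -> exists C rho : R,
  [/\ 0 < rho, 0 <= C & forall x y, `|x - q| <= rho -> `|y - q| <= rho ->
   `|cnum t y y / cden t y y - cnum t x x / cden t x x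
     - cdiff t x (y - x) / cden t x x ^+ 2| <= C * `|y - x| ^+ 2].
Proof.
move=> q0; have [rho rho0 H] := cden_near q0.
set e := `|cden t q q| in H.
have e0 : 0 < e by rewrite normr_gt0.
(* On the ball [|x| <= b] and [|v| <= 2 * b]; as [M] exceeds [16], [16 * b] and [16 * b ^ 2], it
   provides all the bounds of [quotient_taylor]. *)
pose b := `|q| + rho + 1; pose M := 16 * (b + 1) ^+ 2.
have b1 : 1 <= b by rewrite /b; have := normr_ge0 q; lra.
exists (6 * M ^+ 3 / (e / 2) ^+ 3), rho; split => //.
  by rewrite !mulr_ge0// ?invr_ge0 ?exprn_ge0// ?mulr_ge0 ?sqr_ge0//; lra.
have He x : `|x - q| <= rho -> e / 2 <= `|cden t x x|.
  move=> /H xe.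
  have : e <= `|cden t x x| + `|cden t x x - cden t q q|.
    by rewrite /e -{1}[cden t q q](subKr (cden t x x)) ler_normB.
  lra.
have xb x : `|x - q| <= rho -> `|x| <= b.
  move=> xq; rewrite -[x](subrK q); apply: le_trans (ler_normD _ _) _.
  by rewrite /b; lra.
move=> x y xq yq; pose v := y - x.
have vb : `|v| <= 2 * b.
  apply: le_trans (ler_normB _ _) _; have := xb _ xq; have := xb _ yq; lra.
have yE : y = x + v by rewrite /v addrC subrK.
have d := He _ yq; have xb' := xb _ xq.
rewrite -/v [in cnum t y y]yE [in cden t y y]yE cnumD cdenD /cdiff.
rewrite [in cden t y y]yE cdenD in d.
have v0 : 0 <= `|v| by [].
have vv0 : 0 <= `|v| * `|v| by rewrite mulr_ge0.
have vv : `|v| * `|v| <= 2 * b * `|v| by exact: ler_wpM2r.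
have xv : `|x| * `|v| <= b * `|v| by exact: ler_wpM2r.
have xx : `|x| * `|x| <= b * b by exact: ler_pM.
have bM : 16 * b <= M by rewrite /M; nra.
have bM' : 16 * (b * b) <= M by rewrite /M; nra.
have bMv : 16 * b * `|v| <= M * `|v| by exact: ler_wpM2r.
have M16 : 16 * (`|v| * `|v|) <= M * (`|v| * `|v|).
  by apply: ler_wpM2r; [rewrite mulr_ge0|rewrite /M; nra].
apply: quotient_taylor; rewrite ?normr_ge0 ?expr2//.
- by rewrite divr_gt0.
- lra.
- by have := le_cnum t x x; lra.
- by have := le_cden t x x; lra.
- apply: le_trans (ler_normD _ _) _.
  by have := le_cnum t x v; have := le_cnum t v x; rewrite (mulrC `|v|); lra.
- apply: le_trans (ler_normD _ _) _.
  by have := le_cden t x v; have := le_cden t v x; rewrite (mulrC `|v|); lra.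
- by have := le_cnum t v v; lra.
- by have := le_cden t v v; lra.
- by have := le_cden t v v; lra.
- exact: He.
Qed.

Section Family.
Variables (k : nat) (tt : 'I_k -> constraint n).

Definition cvalue x : 'rV[R]_k :=
  \row_i (cnum (tt i) x x / cden (tt i) x x).

(** The factors of the quotient rule, kept apart so that [cjacobian] remains polynomial. *)
Definition cscale x : 'rV[R]_k := \row_i (cden (tt i) x x ^+ 2)^-1.

Definition cderiv x : 'M[R]_(n * 2, k) := cjacobian tt x *m diag_mx (cscale x).

Lemma cvalue_taylor q : (forall i, cden (tt i) q q != 0) ->
  taylor_near cvalue cderiv q.
Proof.
move=> q0.
have [f fP] := choice (fun i => constraint_taylor (q0 i)).
have [g gP] := choice fP.
have C0 i : 0 <= f i by case: (gP i).
exists (\sum_i f i), (\big[Num.min/1]_i g i); split.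
- by apply: lt_bigmin => // i _; case: (gP i).
- by apply: sumr_ge0.
move=> x y xq yq; apply: mx_norm_leP => [|i0 i].
  by rewrite mulr_ge0 ?sqr_ge0// sumr_ge0.
have E : ((y - x) *m cderiv x) 0 i =
    cdiff (tt i) x (y - x) / cden (tt i) x x ^+ 2.
  by rewrite /cderiv mulmxA mul_mx_diag mxE mul_cjacobian mxE.
rewrite (ord1 i0) mxE [X in `|_ + X|]mxE E !mxE.
have [r0 _ H] := gP i.
have le z : `|z - q| <= \big[Num.min/1]_i g i -> `|z - q| <= g i.
  by move=> /le_trans; apply; exact: bigmin_le.
apply: le_trans (H _ _ (le _ xq) (le _ yq)) _.
apply: ler_wpM2r; first exact: sqr_ge0.
by rewrite (bigD1 i)//= lerDl sumr_ge0.
Qed.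

(** Diagonal matrices commute, so the scaling moves to the right, where it cannot increase the rank.
    This holds at every [x], even where a denominator vanishes. *)
Lemma rank_cderiv (d : 'rV[R]_k) x :
  (\rank (cderiv x *m diag_mx d) <= \rank (cjacobian tt x *m diag_mx d))%N.
Proof.
by rewrite /cderiv -mulmxA diag_mxC mulmxA; exact: mxrankM_maxl.
Qed.

Lemma rank_cderivE (d : 'rV[R]_k) x : (forall i, cden (tt i) x x != 0) ->
  \rank (cderiv x *m diag_mx d) = \rank (cjacobian tt x *m diag_mx d).
Proof.
move=> x0; rewrite /cderiv -mulmxA diag_mxC mulmxA mxrankMfree//.
rewrite row_free_unit unitmxE det_diag unitfE; apply/prodf_neq0 => i _.
by rewrite mxE invr_neq0// expf_neq0.
Qed.

End Family.
End ConstraintAnalysis.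

(** * Local determination of constraints as a rank condition *)

Lemma exists_kernel_row (F : fieldType) m k l (A : 'M[F]_(m, k))
    (B : 'M[F]_(m, l)) : (\rank A < \rank B)%N ->
  exists2 v : 'rV[F]_m, v *m A = 0 & v *m B != 0.
Proof.
move=> AB; have : ~~ (kermx A <= kermx B)%MS.
  apply: contraTN AB => /mxrankS; rewrite !mxrank_ker -leqNgt.
  by rewrite leq_sub2lE ?rank_leq_row.
case/row_subPn => i; rewrite sub_kermx => iB.
by exists (row i (kermx A)) => //; apply/sub_kermxP; exact: row_sub.
Qed.

Lemma taylor_near_mulmx (R : realType) m k l (h : 'rV[R]_m -> 'rV[R]_k)
    (J : 'rV[R]_m -> 'M[R]_(m, k)) q (B : 'M[R]_(k, l)) :
  taylor_near h J q -> taylor_near (fun x => h x *m B) (fun x => J x *m B) q.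
Proof.
move=> [C [rho [rho0 C0 H]]].
exists (k%:R * `|B| * C), rho; split => //; first by rewrite !mulr_ge0.
move=> x y xq yq; rewrite mulmxA -!mulmxBl.
apply: le_trans (mx_norm_mulmx _ _) _; rewrite -[leRHS]mulrA.
by apply: ler_wpM2l (H _ _ xq yq); rewrite mulr_ge0.
Qed.

Section Determined.
Variables (R : realType) (n : nat) (G K : {set constraint n}).
Hypothesis Knd : forall t : constraint n, t \in K -> well_formed t.
Hypothesis GK : G \subset K.
Implicit Types x y v p q : 'rV[R]_(n * 2).

Definition cratio (t : constraint n) x : R := cnum t x x / cden t x x.

(** Rigidity in terms of the quotients, for [G] and [K] the constraints of the graph and of the
    complete graph. One inclusion of fibers is stated; the other follows from [GK]. *)
Definition locally_determined q := exists2 d : R, 0 < d & forall y,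
  `|y - q| <= d ->
  (forall t : constraint n, t \in G -> cratio t y = cratio t q) ->
  forall t : constraint n, t \in K -> cratio t y = cratio t q.

Let tt (i : 'I_#|K|) : constraint n := enum_val i.

(** The columns outside [G] are zeroed rather than deleted, so both families keep the same index
    type; integer entries keep the matrices polynomial. *)
Definition selection : 'rV[int]_#|K| := \row_i (tt i \in G)%:R.

Let sel : 'rV[R]_#|K| := map_mx intr selection.

Let selE : map_mx intr (diag_mx selection) = diag_mx sel.
Proof. by rewrite map_diag_mx. Qed.

Let tt_neq0 q : mpoly_generic q -> forall i, cden (tt i) q q != 0.
Proof.
by move=> gq i; apply: generic_cden_neq0 => //; apply: Knd; exact: enum_valP.
Qed.

Let cvalue_sel y q : cvalue tt y *m diag_mx sel = cvalue tt q *m diag_mx sel <->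
  forall t : constraint n, t \in G -> cratio t y = cratio t q.
Proof.
split=> [E t tG|E].
  have tK : t \in K := fintype.subsetP GK _ tG.
  move/rowP: E => /(_ (enum_rank_in tK t)).
  by rewrite !mul_mx_diag !mxE /tt enum_rankK_in// tG mulr1z !mulr1.
apply/rowP => i; rewrite !mul_mx_diag !mxE.
have [/E|_] := boolP (tt i \in G); last by rewrite mulr0z !mulr0.
by rewrite /cratio => ->.
Qed.

Let cvalueP y q : cvalue tt y = cvalue tt q <->
  forall t : constraint n, t \in K -> cratio t y = cratio t q.
Proof.
split=> [E t tK|E].
  by move/rowP: E => /(_ (enum_rank_in tK t)); rewrite !mxE /tt enum_rankK_in.
by apply/rowP => i; rewrite !mxE; apply: E; exact: enum_valP.
Qed.


(** Otherwise some direction [v] annihilates the derivatives of the constraints in [G] but not all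
    those in [K]. A curve tangent to [v] in the fiber of [G] then keeps the constraints in [K]
    constant, although they vary to first order along [v]. *)
Lemma locally_determined_rank p : mpoly_generic p -> locally_determined p ->
  (\rank (cjacobian tt p) <= \rank (cjacobian tt p *m diag_mx sel))%N.
Proof.
move=> gp [d d0 ld]; rewrite leqNgt; apply/negP => lt.
have p0 := tt_neq0 gp.
have T := cvalue_taylor p0.
have TG := taylor_near_mulmx (diag_mx sel) T.
have [|v vG vK] := @exists_kernel_row _ _ _ _ (cderiv tt p *m diag_mx sel)
    (cderiv tt p).
  rewrite rank_cderivE//.
  have := @rank_cderivE _ _ _ tt (const_mx 1) p p0.
  by rewrite diag_const_mx !mulmx1 => ->.
have [L [S LS]] := rank_factor (cderiv tt p *m diag_mx sel).
have rk : exists2 rho : R, 0 < rho & forall x, `|x - p| <= rho ->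
    (\rank (cderiv tt x *m diag_mx sel) <=
     \rank (cderiv tt p *m diag_mx sel))%N.
  exists 1 => // x _; apply: leq_trans (rank_cderiv _ _ _) _.
  by rewrite rank_cderivE// -selE; exact: generic_cjacobian_rank.
have [d1 d10 Hd1] := constant_rank_fiber TG LS rk.
have vS : v *m (cderiv tt p *m diag_mx sel) *m S = 0 by rewrite vG mul0mx.
have [M [d2 [d20 M0 H2]]] := fiber_curve TG LS vS.
have [C [rho [rho0 C0 H]]] := T.
have vJ0 : 0 < `|v *m cderiv tt p| by rewrite normr_gt0.
set e := `|v *m cderiv tt p| in vJ0.
pose N := C * M ^+ 2 + (n * 2)%:R * `|cderiv tt p| * M + 1.
have N0 : 0 < N.
  by rewrite /N ltr_wpDl// addr_ge0// !mulr_ge0// sqr_ge0.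
pose dd := Num.min (Num.min d d1) rho.
have dd0 : 0 < dd by rewrite !lt_min d0 d10.
pose t := Num.min (Num.min d2 (dd / (M + 1))) (e / (2 * N)).
have M1 : 0 < M + 1 by rewrite ltr_wpDl.
have t0 : 0 < t by rewrite !lt_min d20 !divr_gt0// mulr_gt0.
have [td2 tdd tN] : [/\ t <= d2, t <= dd / (M + 1) & t <= e / (2 * N)].
  by split; rewrite /t !ge_min lexx ?orbT.
have [|x [xS xp xtv]] := H2 t; first by rewrite gtr0_norm.
rewrite gtr0_norm// in xp.
have xdd : `|x - p| <= dd.
  apply: le_trans xp _; rewrite ler_pdivlMr// in tdd.
  by apply: le_trans tdd; rewrite mulrC ler_wpM2l ?lerDl ?ler01// ltW.
have [xd xd1 xrho] : [/\ `|x - p| <= d, `|x - p| <= d1 & `|x - p| <= rho].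
  by move: xdd; rewrite !le_min => /andP[/andP[]].
have xG := Hd1 _ xd1 xS.
have /cvalueP xK : forall s : constraint n, s \in K -> cratio s x = cratio s p.
  by apply: ld => //; apply/cvalue_sel.
have pp : `|p - p| <= rho by rewrite subrr normr0 ltW.
have := H _ _ pp xrho; rewrite xK subrr sub0r normrN => a.
have b : `|(x - p - t *: v) *m cderiv tt p| <=
    (n * 2)%:R * `|cderiv tt p| * (M * t ^+ 2).
  apply: le_trans (mx_norm_mulmx _ _) _.
  by apply: ler_wpM2l => //; rewrite mulr_ge0.
have tE : t * e <= N * t ^+ 2.
  have -> : t * e = `|(x - p) *m cderiv tt p - (x - p - t *: v) *m cderiv tt p|.
    by rewrite -mulmxBl subKr -scalemxAl normrZ gtr0_norm.
  apply: le_trans (ler_normB _ _) _; apply: le_trans (lerD a b) _.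
  rewrite /N [leRHS]mulrDl [in leRHS]mulrDl mul1r.
  apply: ler_wpDr; first exact: sqr_ge0.
  apply: lerD; last by rewrite -[leRHS]mulrA.
  rewrite -[leRHS]mulrA -exprMn; apply: ler_wpM2l => //.
  by rewrite ler_pXn2r// nnegrE// mulr_ge0// ltW.
have eN : e <= N * t by rewrite -(ler_pM2l t0) mulrCA -expr2.
move: tN; rewrite ler_pdivlMr ?mulr_gt0// => /le_trans/(_ eN).
by rewrite mulrCA [t * N]mulrC ger_pMl ?mulr_gt0// lern1.
Qed.

(** When the ranks agree, combinations of the constraints in [G] alone, given by [diag_mx sel *m S],
    serve as the submersion in the constant rank theorem for all of [K]. *)
Lemma rank_locally_determined q : mpoly_generic q ->
  (\rank (cjacobian tt q) <= \rank (cjacobian tt q *m diag_mx sel))%N ->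
  locally_determined q.
Proof.
move=> gq rq; have q0 := tt_neq0 gq.
have T := cvalue_taylor q0.
have [L [S LS]] := rank_factor (cderiv tt q *m diag_mx sel).
rewrite mulmxA -(mulmxA _ (diag_mx sel)) in LS.
have rk : exists2 rho : R, 0 < rho & forall x, `|x - q| <= rho ->
    (\rank (cderiv tt x) <= \rank (cderiv tt q *m diag_mx sel))%N.
  exists 1 => // x _; rewrite rank_cderivE//; apply: leq_trans rq.
  apply: leq_trans (mxrankM_maxl _ _) _.
  have := generic_cjacobian_rank tt 1%:M x gq.
  by rewrite map_mx1 !mulmx1.
have [d d0 H] := constant_rank_fiber T LS rk.
exists d => // y yd /cvalue_sel yG; apply/cvalueP.
by apply: H => //; rewrite !mulmxA yG.
Qed.

(** The rank for [K] at [q] is at most that at [p], hence at most the rank for [G] at [p], and so at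
    most that at [q]. *)
Lemma locally_determined_generic p q : mpoly_generic p -> mpoly_generic q ->
  locally_determined p -> locally_determined q.
Proof.
move=> gp gq ldp; apply: rank_locally_determined => //.
have a := generic_cjacobian_rank tt 1%:M q gp.
have b := generic_cjacobian_rank tt (diag_mx selection) p gq.
rewrite map_mx1 !mulmx1 in a; rewrite selE in b.
exact: leq_trans a (leq_trans (locally_determined_rank gp ldp) b).
Qed.

End Determined.

(** * Signed angles and their tangents *)

Section PlanarAngles.
Variable R : realType.

Lemma sum_ord2 (V : nmodType) (f : 'I_2 -> V) : \sum_i f i = f 0 + f 1.
Proof.
rewrite !big_ord_recl big_ord0 addr0; congr (_ + f _); exact/val_inj.
Qed.

Lemma enorm_sq (v : 'cV[R]_2) : enorm v ^+ 2 = v 0 0 ^+ 2 + v 1 0 ^+ 2.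
Proof. by rewrite sqr_sqrtr ?sum_ord2// addr_ge0 ?sqr_ge0. Qed.

Lemma enorm_ge0 (v : 'cV[R]_2) : 0 <= enorm v.
Proof. exact: sqrtr_ge0. Qed.

Lemma rotation_mul (a : R) (b : 'cV[R]_2) :
  (rotation a *m b) 0 0 = cos a * b 0 0 - sin a * b 1 0 /\
  (rotation a *m b) 1 0 = sin a * b 0 0 + cos a * b 1 0.
Proof. by rewrite !mxE !sum_ord2 !mxE /=; split; ring. Qed.

Lemma cos_sin_signed_angle (b c : 'cV[R]_2) : enorm b = 1 -> enorm c = 1 ->
  cos (signed_angle b c) = b 0 0 * c 0 0 + b 1 0 * c 1 0 /\
  sin (signed_angle b c) = b 0 0 * c 1 0 - b 1 0 * c 0 0.
Proof.
move=> b1 c1; have [_ cE] := (signed_angleP _ b1 c1).1 erefl.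
have := enorm_sq b; rewrite b1 expr1n => bb.
have [c0E c1E] := rotation_mul (signed_angle b c) b.
rewrite -cE in c0E c1E; rewrite c0E c1E.
by split; rewrite -[LHS]mulr1 bb; ring.
Qed.

Lemma eq_signed_angle (b c b' c' : 'cV[R]_2) :
  enorm b = 1 -> enorm c = 1 -> enorm b' = 1 -> enorm c' = 1 ->
  signed_angle b c = signed_angle b' c' <->
  b 0 0 * c 0 0 + b 1 0 * c 1 0 = b' 0 0 * c' 0 0 + b' 1 0 * c' 1 0 /\
  b 0 0 * c 1 0 - b 1 0 * c 0 0 = b' 0 0 * c' 1 0 - b' 1 0 * c' 0 0.
Proof.
move=> b1 c1 b'1 c'1.
have [<- <-] := cos_sin_signed_angle b1 c1.
have [C S] := cos_sin_signed_angle b'1 c'1; rewrite -C -S.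
split=> [->//|[cE sE]]; apply/signed_angleP => //.
have [H _] := (signed_angleP _ b'1 c'1).1 erefl; split=> //.
have [_ {1}->] := (signed_angleP _ b1 c1).1 erefl.
by rewrite /rotation cE sE.
Qed.

(** With [D] a dot product, [N] a cross product and [L] the product of the lengths, [D / L] and
    [N / L] are the cosine and the sine. The tangent fixes an angle modulo pi only; the common sign
    of [D] and [D'] removes the ambiguity. *)
Lemma eq_tangent (D N L D' N' L' : R) : 0 < L -> 0 < L' ->
  D ^+ 2 + N ^+ 2 = L ^+ 2 -> D' ^+ 2 + N' ^+ 2 = L' ^+ 2 -> 0 < D * D' ->
  (D / L = D' / L' /\ N / L = N' / L') <-> N / D = N' / D'.
Proof.
move=> L0 L'0 DN DN' DD.
have D0 : D != 0 by apply: contraTneq DD => ->; rewrite mul0r ltxx.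
have D'0 : D' != 0 by apply: contraTneq DD => ->; rewrite mulr0 ltxx.
have L1 : L != 0 by rewrite gt_eqF.
have L1' : L' != 0 by rewrite gt_eqF.
split=> [[DE NE]|E].
  have -> : N / D = (N / L) / (D / L) by field; rewrite L1 D0.
  by rewrite DE NE; field; rewrite L1' D'0.
have DE : D / L = D' / L'.
  have pos : 0 < (D / L) * (D' / L').
    by rewrite mulrACA mulr_gt0// mulr_gt0// invr_gt0.
  have : (L / D) ^+ 2 = (L' / D') ^+ 2.
    have -> : (L / D) ^+ 2 = 1 + (N / D) ^+ 2.
      by rewrite !exprMn -DN; field.
    by rewrite E !exprMn -DN'; field.
  move/eqP; rewrite eqf_sqr => /orP[] /eqP F.
    by rewrite -invf_div F invf_div.
  move: pos; rewrite -[D / L]invf_div F invrN invf_div mulNr -expr2 oppr_gt0.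
  by rewrite ltNge sqr_ge0.
split=> //.
have -> : N / L = (N / D) * (D / L) by field; rewrite L1 D0.
by rewrite E DE; field; rewrite L1' D'0.
Qed.

End PlanarAngles.

(** * From angles and ratios of distances to the quotients *)

Section Bridge.
Variables (R : realType) (n : nat).
Implicit Types (p q y dp : 'M[R]_(n, 2)) (e : rel 'I_n) (A D : {set 'I_n}).

Lemma edge_vecE p i j c : edge_vec p i j c 0 = edge_coord (mxvec p) i j c.
Proof. by rewrite /edge_coord !mxvecE !mxE. Qed.

Lemma edge_len_sq p i j :
  edge_len p i j ^+ 2 = edge_dot (mxvec p) (mxvec p) i j j.
Proof. by rewrite enorm_sq !edge_vecE /edge_dot !expr2. Qed.

Definition edges_gt0 p := forall i j : 'I_n, i != j -> 0 < edge_len p i j.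

Lemma bearingE p i j c :
  bearing p i j c 0 = edge_coord (mxvec p) i j c / edge_len p i j.
Proof. by rewrite mxE edge_vecE mulrC. Qed.

Lemma enorm_bearing p i j : 0 < edge_len p i j -> enorm (bearing p i j) = 1.
Proof.
move=> l0; have l2 : edge_len p i j ^+ 2 != 0 by rewrite expf_neq0// gt_eqF.
have : enorm (bearing p i j) ^+ 2 = 1.
  rewrite enorm_sq !bearingE !expr_div_n -mulrDl.
  rewrite (_ : _ + _ = edge_len p i j ^+ 2) ?divff//.
  by rewrite edge_len_sq /edge_dot !expr2.
move/eqP; rewrite sqrf_eq1 => /orP[] /eqP // E.
by have := enorm_ge0 (bearing p i j); rewrite E ler0N1.
Qed.

Lemma eq_alpha y p r s t : r != s -> r != t -> edges_gt0 y -> edges_gt0 p ->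
  0 < cden (inl (r, s, t)) (mxvec y) (mxvec y) *
      cden (inl (r, s, t)) (mxvec p) (mxvec p) ->
  alpha y r s t = alpha p r s t <->
  cratio (inl (r, s, t)) (mxvec y) = cratio (inl (r, s, t)) (mxvec p).
Proof.
move=> rs rt y0 p0 /= DD.
have ys := y0 _ _ rs; have yt := y0 _ _ rt.
have ps := p0 _ _ rs; have pt := p0 _ _ rt.
have H (z : 'M[R]_(n, 2)) : edge_dot (mxvec z) (mxvec z) r s t ^+ 2 +
    edge_cross (mxvec z) (mxvec z) r s t ^+ 2 =
    (edge_len z r s * edge_len z r t) ^+ 2.
  by rewrite [RHS]exprMn !edge_len_sq /edge_dot /edge_cross; ring.
rewrite /cratio /=.
rewrite -(eq_tangent (mulr_gt0 ys yt) (mulr_gt0 ps pt) (H y) (H p) DD).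
rewrite /alpha eq_signed_angle ?enorm_bearing// !bearingE.
have E1 a b c d (l l' : R) :
  a / l * (b / l') + c / l * (d / l') = (a * b + c * d) / (l * l').
  by rewrite invfM; ring.
have E2 a b c d (l l' : R) :
  a / l * (b / l') - c / l * (d / l') = (a * b - c * d) / (l * l').
  by rewrite invfM; ring.
by rewrite !E1// !E2.
Qed.

Lemma eq_kappa y p i j k :
  kappa y i j k = kappa p i j k <->
  cratio (inr (i, j, k)) (mxvec y) = cratio (inr (i, j, k)) (mxvec p).
Proof.
have H (z : 'M[R]_(n, 2)) :
    cratio (inr (i, j, k)) (mxvec z) = kappa z i j k ^+ 2.
  by rewrite /cratio /= /kappa exprMn exprVn !edge_len_sq.
rewrite !H; split=> [->//|] /eqP.
by rewrite eqrXn2 ?divr_ge0 ?enorm_ge0// => /eqP.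
Qed.

Definition constraints (e : rel 'I_n) (A D : {set 'I_n}) : {set constraint n} :=
  [set t | match t with inl x => x \in triples e A
                      | inr x => x \in triples e D end].

Lemma constraints_wf e A D : (forall i j, e i j -> i != j) ->
  forall t : constraint n, t \in constraints e A D -> well_formed t.
Proof.
move=> e0 [] x; rewrite !inE => /and4P[_ /e0 x1 /e0 x2 _] /=; exact/andP.
Qed.

Lemma sub_constraints e A D : (forall i j, e i j -> i != j) ->
  constraints e A D \subset constraints (@complete_graph n) A D.
Proof.
move=> e0; apply/fintype.subsetP => -[] x; rewrite !inE => /and4P[a b c d];
by apply/and4P; split => //; exact: e0.
Qed.

Lemma generic_edges p : generic p -> edges_gt0 p.
Proof.
move=> gp i j ij; rewrite lt_neqAle enorm_ge0 andbT eq_sym.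
rewrite -sqrf_eq0 edge_len_sq.
by apply: (@generic_cden_neq0 _ _ (inr (i, j, j)) _ gp); rewrite /= ij.
Qed.

(** There are finitely many constraints, so one radius keeps the signs of all denominators, as
    [eq_alpha] requires. *)
Lemma generic_near p : generic p -> exists2 d : R, 0 < d & forall y,
  `|mxvec y - mxvec p| <= d -> edges_gt0 y /\
  forall t : constraint n, well_formed t ->
    0 < cden t (mxvec y) (mxvec y) * cden t (mxvec p) (mxvec p).
Proof.
move=> gp.
have ex (t : constraint n) : exists d : R, 0 < d /\ (well_formed t -> forall y,
    `|mxvec y - mxvec p| <= d ->
    0 < cden t (mxvec y) (mxvec y) * cden t (mxvec p) (mxvec p)).
  have [wf|] := boolP (well_formed t); last by exists 1.
  have p0 := generic_cden_neq0 (gp : mpoly_generic (mxvec p)) wf.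
  have [d d0 H] := cden_near p0; exists d; split => // _ y /H.
  move: p0; move: (cden t _ _) (cden t _ _) => a b b0; rewrite ler_norml.
  have [b1|b1] := ltrP 0 b.
    by rewrite gtr0_norm// => /andP[h _]; rewrite mulr_gt0//; lra.
  have {}b1 : b < 0 by rewrite lt_neqAle b0.
  by rewrite ltr0_norm// => /andP[_ h]; rewrite nmulr_rgt0//; lra.
have [f fP] := choice ex.
exists (\big[Num.min/1]_t f t).
  by apply: lt_bigmin => // t _; case: (fP t).
move=> y yp.
have H t : well_formed t ->
    0 < cden t (mxvec y) (mxvec y) * cden t (mxvec p) (mxvec p).
  move=> wf; apply: (fP t).2 => //; apply: le_trans yp _; exact: bigmin_le.
split=> // i j ij.
rewrite lt_neqAle enorm_ge0 andbT eq_sym -sqrf_eq0 edge_len_sq.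
have := H (inr (i, j, j)); rewrite /= ij => /(_ isT).
by apply: contraTneq => ->; rewrite mul0r ltxx.
Qed.

Lemma sarod_fiber_near e A D p : (forall i j, e i j -> i != j) -> generic p ->
  exists2 d : R, 0 < d & forall y, `|mxvec y - mxvec p| <= d ->
    (sarod_fiber e A D p y <->
     forall t : constraint n, t \in constraints e A D ->
      cratio t (mxvec y) = cratio t (mxvec p)).
Proof.
move=> e0 gp; have [d d0 H] := generic_near gp; exists d => // y /H[yl yD].
have pl := generic_edges gp.
split=> [[_ /ffunP E] [] x xT|E].
- have := xT; rewrite inE => xA.
  have := E (inl (exist _ x xA)); rewrite !ffunE /=.
  have /andP[x1 x2] := constraints_wf e0 xT.
  case: x xT xA x1 x2 => [[r s] t] xT xA x1 x2.
  by move/eq_alpha; apply=> //; apply: yD; exact: constraints_wf xT.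
- have := xT; rewrite inE => xA.
  have := E (inr (exist _ x xA)); rewrite !ffunE /=.
  by case: x xT xA => [[i j] k] xT xA /eq_kappa.
split=> [i j /e0 ij pij|].
  have := yl _ _ ij.
  rewrite /edge_len /edge_vec pij subrr /enorm sum_ord2 !mxE.
  by rewrite expr0n addr0 sqrtr0 ltxx.
apply/ffunP => -[] [x xT]; rewrite !ffunE /=.
  have xC : (inl x : constraint n) \in constraints e A D by rewrite inE.
  have := E _ xC; have /andP[x1 x2] := constraints_wf e0 xC.
  case: x xT xC x1 x2 => [[r s] t] xT xC x1 x2 Ex.
  by apply/eq_alpha => //; apply: yD; exact: constraints_wf xC.
have xC : (inr x : constraint n) \in constraints e A D by rewrite inE.
have := E _ xC; case: x xT xC => [[i j] k] xT xC Ex.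
exact/eq_kappa.
Qed.

Lemma norm_mxvec (M : 'M[R]_(n, 2)) : `|mxvec M| = `|M|.
Proof.
apply/le_anti/andP; split; apply: mx_norm_leP => // i j.
  rewrite (ord1 i); case/mxvec_indexP: j => a b.
  by rewrite mxvecE; exact: le_mx_norm.
by rewrite -mxvecE; exact: le_mx_norm.
Qed.

Lemma sarod_rigidP e A D p : (forall i j, e i j -> i != j) -> generic p ->
  sarod_rigid e A D p <-> locally_determined (constraints e A D)
    (constraints (@complete_graph n) A D) (mxvec p).
Proof.
move=> e0 gp; have c0 i j : @complete_graph n i j -> i != j by [].
have [d1 d10 H1] := sarod_fiber_near A D e0 gp.
have [d2 d20 H2] := sarod_fiber_near A D c0 gp.
have le y d : `|mxvec y - mxvec p| <= d = (`|y - p| <= d).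
  by rewrite -linearB norm_mxvec.
split=> [[U [Uo Up UE]]|[d d0 H]].
  have /nbhs_ballP[eps /= eps0 epsU] : nbhs p U by exact: open_nbhs_nbhs.
  (* Half of [eps], since [locally_determined] uses closed balls and [epsU] an open one. *)
  exists (Num.min (eps / 2) (Num.min d1 d2)).
    by rewrite !lt_min divr_gt0// d10 d20.
  move=> y'; rewrite -[y']vec_mxK; move: (vec_mx y') => y.
  rewrite !le_min => /and3P[yeps y1 y2] yG.
  apply/(H2 _ y2).
  have Uy : U y.
    apply: epsU; rewrite -ball_normE /= distrC -norm_mxvec linearB; lra.
  suff : (sarod_fiber (@complete_graph n) A D p `&` U) y by case.
  by rewrite -UE; split => //; exact/(H1 _ y1).
pose dd := Num.min d (Num.min d1 d2).
have dd0 : 0 < dd by rewrite !lt_min d0 d10 d20.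
exists (ball p dd); split; first exact: ball_open.
  exact: ballxx.
apply/seteqP; split => y [yF yB]; split => //.
  all: move: (yB); rewrite -ball_normE /= distrC -norm_mxvec linearB => /ltW.
  all: rewrite !le_min => /and3P[yd y1 y2].
  by apply/(H2 _ y2); apply: H => //; exact/(H1 _ y1).
apply/(H1 _ y1) => t tG; move/(H2 _ y2): yF; apply.
exact: (fintype.subsetP (sub_constraints A D e0)).
Qed.

End Bridge.

(** * Infinitesimal rigidity as a rank condition *)

Section Infinitesimal.
Variables (R : realType) (n : nat).
Implicit Types (p q dp : 'M[R]_(n, 2)) (e : rel 'I_n) (A D : {set 'I_n}).

(* If v differs from x by an infinitesimal similarity on every edge, then it is
   in the kernel of every constraint. *)
Lemma cdiff_similarity (t : constraint n) (x v : 'rV[R]_(n * 2)) a b :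
  (forall i j, edge_coord v i j 0 =
     a * edge_coord x i j 0 - b * edge_coord x i j 1) ->
  (forall i j, edge_coord v i j 1 =
     b * edge_coord x i j 0 + a * edge_coord x i j 1) ->
  cdiff t x v = 0.
Proof.
move=> v0 v1; case: t => z;
by rewrite /cdiff /= /edge_cross /edge_dot !v0 !v1; ring.
Qed.

Lemma bearing_rotation p dp r s :
  ((bearing p r s)^T *m rotation (pi / 2) *m edge_vec dp r s) 0 0 =
  - edge_cross (mxvec p) (mxvec dp) r s s / edge_len p r s.
Proof.
rewrite !(mxE, sum_ord2) /= cos_pihalf sin_pihalf /edge_cross.
by rewrite /edge_coord !mxvecE; ring.
Qed.

Lemma bearing_dot p dp r s :
  ((bearing p r s)^T *m edge_vec dp r s) 0 0 =
  edge_dot (mxvec p) (mxvec dp) r s s / edge_len p r s.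
Proof.
rewrite [LHS]mxE sum_ord2 [_^T _ _]mxE [_^T _ 1]mxE !bearingE !edge_vecE.
by rewrite /edge_dot; ring.
Qed.

(** The derivative of the angle with tangent [N / D] is that of the quotient times
    [D ^ 2 / (D ^ 2 + N ^ 2)], and [D ^ 2 + N ^ 2] is the product of the squared lengths. *)
Lemma cdiff_dalpha p dp r s t : edges_gt0 p -> r != s -> r != t ->
  cdiff (inl (r, s, t)) (mxvec p) (mxvec dp) =
  edge_len p r s ^+ 2 * edge_len p r t ^+ 2 * dalpha p dp r s t 0 0.
Proof.
move=> p0 /p0 rs /p0 rt.
have -> : dalpha p dp r s t 0 0 =
   - edge_cross (mxvec p) (mxvec dp) r s s / edge_len p r s ^+ 2 +
   edge_cross (mxvec p) (mxvec dp) r t t / edge_len p r t ^+ 2.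
  rewrite /dalpha 2![in LHS]mxE [X in _ + X]mxE [X in _ - X]mxE.
  rewrite !bearing_rotation.
  by field; rewrite !gt_eqF.
transitivity (- edge_len p r t ^+ 2 * edge_cross (mxvec p) (mxvec dp) r s s +
   edge_len p r s ^+ 2 * edge_cross (mxvec p) (mxvec dp) r t t).
  by rewrite !edge_len_sq /cdiff /= /edge_cross /edge_dot; ring.
by field; rewrite !gt_eqF.
Qed.

(** The factor 2 arises because the quotient is the square of the ratio, while [dkappa] is a
    logarithmic derivative. *)
Lemma cdiff_dkappa p dp i j k : edges_gt0 p -> i != j -> i != k ->
  cdiff (inr (i, j, k)) (mxvec p) (mxvec dp) =
  2 * (edge_len p i j ^+ 2 * edge_len p i k ^+ 2) * dkappa p dp i j k 0 0.
Proof.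
move=> p0 /p0 ij /p0 ik.
have -> : dkappa p dp i j k 0 0 =
   edge_dot (mxvec p) (mxvec dp) i k k / edge_len p i k ^+ 2 -
   edge_dot (mxvec p) (mxvec dp) i j j / edge_len p i j ^+ 2.
  rewrite /dkappa 2![in LHS]mxE [X in _ + X]mxE [X in _ - X]mxE !bearing_dot.
  by field; rewrite !gt_eqF.
transitivity (2 * (edge_len p i j ^+ 2 * edge_dot (mxvec p) (mxvec dp) i k k -
   edge_len p i k ^+ 2 * edge_dot (mxvec p) (mxvec dp) i j j)).
  by rewrite !edge_len_sq /cdiff /= /edge_dot; ring.
by field; rewrite !gt_eqF.
Qed.

Let jac e A D (p : 'M[R]_(n, 2)) :=
  cjacobian (fun i : 'I_#|constraints e A D| => enum_val i) (mxvec p).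

Lemma infinitesimal_motionP e A D p dp : (forall i j, e i j -> i != j) ->
  edges_gt0 p ->
  infinitesimal_motion e A D p dp <-> mxvec dp *m jac e A D p = 0.
Proof.
move=> e0 p0.
have -> : mxvec dp *m jac e A D p = 0 <-> forall t : constraint n,
    t \in constraints e A D -> cdiff t (mxvec p) (mxvec dp) = 0.
  split=> [E t tC|E].
    move/rowP: E => /(_ (enum_rank_in tC t)).
    by rewrite mul_cjacobian enum_rankK_in// mxE.
  by apply/rowP => i; rewrite mul_cjacobian mxE; apply: E; exact: enum_valP.
have z (M : 'M[R]_1) : M = 0 <-> M 0 0 = 0.
  by split=> [->|M0]; [rewrite mxE|apply/matrixP => i j; rewrite !ord1 mxE].
split=> [[HA HD] [[[r s] t]|[[i j] k]] tC|E].
- have := tC; rewrite inE => /HA; have /andP[/= rs rt] := constraints_wf e0 tC.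
  by rewrite cdiff_dalpha// => ->; rewrite mxE mulr0.
- have := tC; rewrite inE => /HD; have /andP[/= ij ik] := constraints_wf e0 tC.
  by rewrite cdiff_dkappa// => ->; rewrite mxE mulr0.
split=> [r s t tT|i j k tT].
  have tC : (inl (r, s, t) : constraint n) \in constraints e A D by rewrite inE.
  have /andP[/= rs rt] := constraints_wf e0 tC.
  move/eqP: (E _ tC); rewrite cdiff_dalpha// !mulf_eq0 ?expf_eq0 /=.
  by rewrite (gt_eqF (p0 _ _ rs)) (gt_eqF (p0 _ _ rt)) => /eqP/z.
have tC : (inr (i, j, k) : constraint n) \in constraints e A D by rewrite inE.
have /andP[/= rs rt] := constraints_wf e0 tC.
move/eqP: (E _ tC); rewrite cdiff_dkappa// !mulf_eq0 ?expf_eq0 /= pnatr_eq0.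
by rewrite (gt_eqF (p0 _ _ rs)) (gt_eqF (p0 _ _ rt)) => /eqP/z.
Qed.

Let motions p : 4.-tuple 'M[R]_(n, 2) :=
  [tuple translation R n 0; translation R n 1; p *m (rotation (pi / 2))^T; p].

Let motion_mx p : 'M[R]_(4, n * 2) :=
  \matrix_(i < 4) mxvec (tnth (motions p) i).

Let trivial_motionsP p dp :
  dp \in trivial_motions p = (mxvec dp <= motion_mx p)%MS.
Proof.
apply/idP/idP => [/(@coord_span _ _ _ (motions p)) ->|/submxP[u E]].
  rewrite linear_sum /=; apply: summx_sub => i _; rewrite linearZ /=.
  apply: scalemx_sub.
  suff -> : mxvec (motions p)`_i = row i (motion_mx p) by exact: row_sub.
  by rewrite rowK (tnth_nth 0).
have -> : dp = \sum_i u 0 i *: tnth (motions p) i.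
  apply: (can_inj mxvecK); rewrite E mulmx_sum_row linear_sum.
  apply: eq_bigr => i _.
  by rewrite linearZ rowK.
apply: memv_suml => i _; apply: memvZ; apply: memv_span; exact: mem_tnth.
Qed.

Let rot_coord p i j :
  edge_coord (mxvec (p *m (rotation (pi / 2))^T)) i j 0 =
    - edge_coord (mxvec p) i j 1 /\
  edge_coord (mxvec (p *m (rotation (pi / 2))^T)) i j 1 =
    edge_coord (mxvec p) i j 0.
Proof.
rewrite /edge_coord !mxvecE !mxE !sum_ord2 !mxE /= cos_pihalf sin_pihalf.
by split; ring.
Qed.

Let translation_coord c i j d :
  edge_coord (mxvec (translation R n c)) i j d = 0.
Proof. by rewrite /edge_coord !mxvecE !mxE subrr. Qed.

(** In [cdiff_similarity], translations have [a = b = 0], the rotation [a = 0], [b = 1], and the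
    dilation [a = 1], [b = 0]. *)
Let motion_mx_ker e A D p : motion_mx p *m jac e A D p = 0.
Proof.
apply/row_matrixP => i; rewrite row_mul rowK row0; apply/rowP => l.
rewrite mul_cjacobian mxE; move: (enum_val l) => t.
have : tnth (motions p) i \in motions p by exact: mem_tnth.
rewrite !inE => /or4P[] /eqP ->.
- by apply: (@cdiff_similarity _ _ _ 0 0) => *; rewrite translation_coord; ring.
- by apply: (@cdiff_similarity _ _ _ 0 0) => *; rewrite translation_coord; ring.
- by apply: (@cdiff_similarity _ _ _ 0 1) => i' j';
    have [E0 E1] := rot_coord p i' j'; rewrite ?E0 ?E1; ring.
- by apply: (@cdiff_similarity _ _ _ 1 0) => *; ring.
Qed.

(** In complex notation, a combination of the motions sends a point [z] to
    [(a + i b) + (d + i c) z]; if this vanishes at two distinct points, all coefficients are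
    zero. *)
Let motion_mx_free p : (1 < n)%N -> edges_gt0 p -> row_free (motion_mx p).
Proof.
move=> n1 p0; apply: inj_row_free => u uM.
pose i0 : 'I_n := Ordinal (ltnW n1); pose i1 : 'I_n := Ordinal n1.
have l : 0 < edge_len p i0 i1 ^+ 2 by rewrite exprn_gt0// p0.
have M j i c : motion_mx p j (mxvec_index i c) = (motions p)`_j i c.
  by rewrite mxE mxvecE (tnth_nth 0).
pose a := u 0 ord0; pose b := u 0 (lift ord0 ord0).
pose c := u 0 (lift ord0 (lift ord0 ord0)).
pose d := u 0 (lift ord0 (lift ord0 (lift ord0 ord0))).
have E i k : a * translation R n 0 i k + b * translation R n 1 i k +
    c * (p *m (rotation (pi / 2))^T) i k + d * p i k = 0.
  move/rowP: uM => /(_ (mxvec_index i k)).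
  rewrite [LHS]mxE [RHS]mxE !big_ord_recl big_ord0 addr0 !M /= !addrA; exact.
have rotE i : (p *m (rotation (pi / 2))^T) i 0 = - p i 1 /\
    (p *m (rotation (pi / 2))^T) i 1 = p i 0.
  by rewrite !mxE !sum_ord2 !mxE /= cos_pihalf sin_pihalf; split; ring.
have E0 i : a - c * p i 1 + d * p i 0 = 0.
  by rewrite -[RHS](E i 0) (rotE i).1 !mxE /=; ring.
have E1 i : b + c * p i 0 + d * p i 1 = 0.
  by rewrite -[RHS](E i 1) (rotE i).2 !mxE /=; ring.
have l2 : edge_len p i0 i1 ^+ 2 =
    (p i1 0 - p i0 0) ^+ 2 + (p i1 1 - p i0 1) ^+ 2.
  by rewrite edge_len_sq /edge_dot /edge_coord !mxvecE !expr2.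
have d0 : d = 0.
  apply: (mulIf (lt0r_neq0 l)); rewrite mul0r l2.
  have := E0 i0; have := E0 i1; have := E1 i0; have := E1 i1.
  move: (p i0 0) (p i0 1) (p i1 0) (p i1 1) => x y x' y' h1 h2 h3 h4.
  (* The real part of the difference of the two equations times the conjugate of the edge; the
     imaginary part gives [c] below. *)
  transitivity ((x' - x) * ((a - c * y' + d * x') - (a - c * y + d * x)) +
    (y' - y) * ((b + c * x' + d * y') - (b + c * x + d * y))); first by ring.
  by rewrite h1 h2 h3 h4; ring.
have c0 : c = 0.
  apply: (mulIf (lt0r_neq0 l)); rewrite mul0r l2.
  have := E0 i0; have := E0 i1; have := E1 i0; have := E1 i1.
  move: (p i0 0) (p i0 1) (p i1 0) (p i1 1) => x y x' y' h1 h2 h3 h4.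
  transitivity ((x' - x) * ((b + c * x' + d * y') - (b + c * x + d * y)) -
    (y' - y) * ((a - c * y' + d * x') - (a - c * y + d * x))); first by ring.
  by rewrite h1 h2 h3 h4; ring.
have a0 : a = 0 by move: (E0 i0); rewrite d0 c0 !mul0r subr0 addr0.
have b0 : b = 0 by move: (E1 i0); rewrite d0 c0 !mul0r !addr0.
apply/rowP => k; rewrite mxE.
by case: (unliftP ord0 k) => [{}k|] ->//;
  case: (unliftP ord0 k) => [{}k|] ->//;
  case: (unliftP ord0 k) => [{}k|] ->//; rewrite (ord1 k).
Qed.

(** Rigidity at [p] bounds the dimension of the kernel by 4, and the kernel at [q] is no larger by
    maximality of the rank. It contains the trivial motions, of dimension 4, so it equals their
    span. *)
Lemma inf_sarod_rigid_generic e A D p q : (1 < n)%N ->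
  (forall i j, e i j -> i != j) -> generic p -> generic q ->
  inf_sarod_rigid e A D p -> inf_sarod_rigid e A D q.
Proof.
move=> n1 e0 gp gq rp dq.
have lp := generic_edges gp; have lq := generic_edges gq.
move/(infinitesimal_motionP _ _ _ e0 lq)/sub_kermxP => /submx_trans.
rewrite trivial_motionsP; apply.
have kp : (kermx (jac e A D p) <= motion_mx p)%MS.
  apply/row_subP => i; rewrite -[row i _]vec_mxK -trivial_motionsP; apply: rp.
  apply/infinitesimal_motionP => //; rewrite vec_mxK.
  by apply/sub_kermxP; exact: row_sub.
have kq : (motion_mx q <= kermx (jac e A D q))%MS.
  exact/sub_kermxP/motion_mx_ker.
rewrite -(geq_leqif (mxrank_leqif_sup kq)).
have /eqP-> := motion_mx_free n1 lq.
apply: leq_trans (rank_leq_row (motion_mx p)); apply: leq_trans (mxrankS kp).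
rewrite !mxrank_ker leq_sub2l//.
have := generic_cjacobian_rank
  (fun i : 'I_#|constraints e A D| => enum_val i) 1%:M (mxvec p)
  (gq : mpoly_generic (mxvec q)).
by rewrite map_mx1 !mulmx1.
Qed.

End Infinitesimal.

Theorem theorem7 (R : realType) (n : nat) (e : rel 'I_n) (A D : {set 'I_n})
    (p : 'M[R]_(n, 2)) :
  (2 < n)%N -> simple_graph e -> node_bipartition A D -> generic p ->
  (sarod_rigid e A D p -> generically_sarod_rigid R e A D) /\
  (inf_sarod_rigid e A D p -> generically_inf_sarod_rigid R e A D).
Proof.
move=> n2 [_ eirr] _ gp.
have e0 i j : e i j -> i != j by apply: contraTneq => ->; rewrite eirr.
split=> [rp q gq|rp q gq].
  apply/(sarod_rigidP _ _ e0 gq); move/(sarod_rigidP _ _ e0 gp): rp.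
  apply: locally_determined_generic => //; last exact: sub_constraints.
  by move=> t; exact: constraints_wf.
exact: inf_sarod_rigid_generic (ltnW n2) e0 gp gq rp.
Qed.
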